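(* Let $G$ be a finite simple connected graph which is complete intersection. Then every minimal generator of $I_G$ is a circuit, i.e. (up to sign) of the form $B_w$ where $w$ is either an even cycle, or two odd cycles intersecting in exactly one vertex, or two vertex-disjoint odd cycles joined by a path.
   Context: For a finite simple graph $G$ with edges $e_1,\dots,e_m$ and a field $K$, the toric ideal $I_G\subseteq K[e_1,\dots,e_m]$ is the kernel of the $K$-algebra map $e_i=\{v_j,v_k\}\mapsto v_jv_k$; $G$ is complete intersection if $I_G$ is generated by $\operatorname{ht}(I_G)$ elements. A minimal generator of $I_G$ is a binomial belonging to at least one minimal system of binomial generators of $I_G$. For an even closed walk $w=(e_{i_1},\dots,e_{i_{2q}})$, $B_w=\prod_{k=1}^q e_{i_{2k-1}}-\prod_{k=1}^q e_{i_{2k}}$. A circuit of $I_G$ is an irreducible binomial of $I_G$ with minimal support; these are exactly the binomials $B_w$ for $w$ an even cycle, two odd cycles intersecting in exactly one vertex (traversed as a closed walk), or two vertex-disjoint odd cycles joined by a path (traversed as closed walk going through the path twice). *)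

(* Defs.v *)
From HB Require Import structures.
From mathcomp Require Import all_boot all_order all_algebra.
From mathcomp Require Import fingraph.
From mathcomp Require Export mpoly.

Set Implicit Arguments.
Unset Strict Implicit.
Unset Printing Implicit Defensive.

Import Order.TTheory GRing.Theory.
Local Open Scope ring_scope.

Section Ideals.
Variable R : comRingType.

Definition is_ideal (I : R -> Prop) : Prop :=
  [/\ I 0, (forall x y, I x -> I y -> I (x + y)) & (forall r x, I x -> I (r * x))].

Definition prime_ideal (P : R -> Prop) : Prop :=
  [/\ is_ideal P, ~ P 1 & (forall x y, P (x * y) -> P x \/ P y)].

Definition in_ideal_gen (s : seq R) (p : R) : Prop :=
  exists c : 'I_(size s) -> R, p = \sum_(i < size s) c i * tnth (in_tuple s) i.

Definition generates (I : R -> Prop) (s : seq R) : Prop :=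
  forall p, I p <-> in_ideal_gen s p.

Definition psubset (I J : R -> Prop) : Prop := forall x, I x -> J x.
Definition pstrict_subset (I J : R -> Prop) : Prop :=
  psubset I J /\ exists x, J x /\ ~ I x.

Definition prime_chain_to (P : R -> Prop) (h : nat) : Prop :=
  exists c : nat -> (R -> Prop),
    [/\ (forall i, (i <= h)%N -> prime_ideal (c i)),
        (forall i, (i < h)%N -> pstrict_subset (c i) (c i.+1)) &
        (forall x, c h x <-> P x)].

Definition prime_height (P : R -> Prop) (h : nat) : Prop :=
  prime_chain_to P h /\ forall k, prime_chain_to P k -> (k <= h)%N.

Definition ideal_height (I : R -> Prop) (h : nat) : Prop :=
  (exists P, [/\ prime_ideal P, psubset I P & prime_height P h]) /\
  (forall P k, prime_ideal P -> psubset I P -> prime_height P k -> (h <= k)%N).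

Definition complete_intersection (I : R -> Prop) : Prop :=
  exists h (s : seq R), [/\ ideal_height I h, size s = h & generates I s].

End Ideals.

Section Graph.
Variables (n m : nat) (ends : 'I_m -> 'I_n * 'I_n).

Definition edge_joins (e : 'I_m) (x y : 'I_n) : bool :=
  (ends e == (x, y)) || (ends e == (y, x)).

Definition simple_graph : Prop :=
  (forall e, (ends e).1 != (ends e).2) /\
  (forall e f, edge_joins f (ends e).1 (ends e).2 -> e = f).

Definition adjacent : rel 'I_n := fun x y => [exists e, edge_joins e x y].

Definition connected_graph : Prop := forall x y, connect adjacent x y.

Variable K : fieldType.

Definition toric_map (p : {mpoly K[m]}) : {mpoly K[n]} :=
  mmap (@mpolyC n K) (fun e : 'I_m => 'X_((ends e).1) * 'X_((ends e).2)) p.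

Definition toric_ideal : {mpoly K[m]} -> Prop := fun p => toric_map p = 0.

Definition binomial (p : {mpoly K[m]}) : Prop :=
  exists u v : 'X_{1..m}, p = 'X_[u] - 'X_[v].

Definition minimal_binomial_generators (I : {mpoly K[m]} -> Prop)
    (s : seq {mpoly K[m]}) : Prop :=
  [/\ forall b, b \in s -> binomial b,
      generates I s &
      forall i, (i < size s)%N -> ~ generates I (take i s ++ drop i.+1 s)].

Definition minimal_generator (I : {mpoly K[m]} -> Prop) (b : {mpoly K[m]}) : Prop :=
  exists s, minimal_binomial_generators I s /\ b \in s.

(* A closed walk is given by its cyclic vertex sequence vs = v_0 ... v_(k-1)
   and edge sequence es = e_1 ... e_k, where e_(j+1) joins v_j and
   v_(j+1 mod k). *)
Definition closed_walk (vs : seq 'I_n) (es : seq 'I_m) : bool :=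
  all2 (fun e p => edge_joins e p.1 p.2) es (zip vs (rot 1 vs)).

(* B_w = e_1 e_3 ... e_(2q-1) - e_2 e_4 ... e_(2q) *)
Definition walk_binomial (es : seq 'I_m) : {mpoly K[m]} :=
  \prod_(p <- zip (iota 0 (size es)) es | ~~ odd p.1) 'X_(p.2)
  - \prod_(p <- zip (iota 0 (size es)) es | odd p.1) 'X_(p.2).

(* vertex list of a cycle (as a cyclic sequence, no repeated vertex) *)
Definition even_cycle_seq (c : seq 'I_n) : bool :=
  [&& uniq c, ~~ odd (size c) & (3 <= size c)%N].
Definition odd_cycle_seq (c : seq 'I_n) : bool :=
  [&& uniq c, odd (size c) & (3 <= size c)%N].

Definition even_cycle_walk (vs : seq 'I_n) : Prop := even_cycle_seq vs.

Definition two_odd_cycles_vertex_walk (vs : seq 'I_n) : Prop :=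
  exists (v : 'I_n) (a b : seq 'I_n),
    [/\ vs = (v :: a) ++ (v :: b), odd_cycle_seq (v :: a), odd_cycle_seq (v :: b)
      & forall x, x \in v :: a -> x \in v :: b -> x = v].

(* w consists of two vertex-disjoint odd cycles c1 (through u) and c2
   (through v) joined by a path pth = u = p_0, p_1, ..., p_l = v (l >= 1)
   meeting c1 only in u and c2 only in v; the walk goes around c1, along
   the path to v, around c2, and back along the path to u. *)
Definition two_odd_cycles_path_walk (vs : seq 'I_n) : Prop :=
  exists (u v : 'I_n) (a b pth : seq 'I_n),
    [/\ vs = (u :: a) ++ take (size pth).-1 pth ++ (v :: b)
               ++ take (size pth).-1 (rev pth),
        [/\ odd_cycle_seq (u :: a), odd_cycle_seq (v :: b)
           & forall x, x \in u :: a -> x \notin v :: b],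
        [/\ uniq pth, (2 <= size pth)%N, head u pth = u & last u pth = v]
      & (forall x, x \in pth -> x \in u :: a -> x = u) /\
        (forall x, x \in pth -> x \in v :: b -> x = v)].

Definition circuit_walk (vs : seq 'I_n) (es : seq 'I_m) : Prop :=
  closed_walk vs es /\
  [\/ even_cycle_walk vs, two_odd_cycles_vertex_walk vs
    | two_odd_cycles_path_walk vs].

End Graph.

Arguments toric_map {n m} ends K p.
Arguments toric_ideal {n m} ends K p.
Arguments walk_binomial {m} K es.
Arguments minimal_generator {m K} I b.
Arguments circuit_walk {n m} ends vs es.

(* Main.v *)
Require Import Defs.
From HB Require Import structures.
From mathcomp Require Import all_boot all_order all_algebra.
From mathcomp Require Import mpoly.
From mathcomp Require Import ssrcomplements zify ring lra.
From Stdlib Require Import Classical ClassicalEpsilon.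

(** Let [A] be the incidence matrix of the graph and [X^p_i - X^q_i] a minimal
    binomial generating set.  Graded Nakayama bounds its size by that of any
    generating set, and counting algebraically independent elements along a
    chain of primes bounds the height of the toric ideal by [m - rank A].  Hence
    the generators are no more numerous than [rank (ker A)].  Comparing growth
    rates then shows that the family is dominating: for every nonempty set [T]
    of variables, fewer than [#|T|] generators have both monomials meeting [T];
    otherwise the ideal generated by the variables of [T] and the remaining
    generators would contain the toric ideal and have too large a quotient.

    A dominating family splits as in the theorem of Fischer and Shapiro: some
    generator has its two monomials supported on the two sides of a partition of
    the edges, and each other generator lives on one side.  Recursively, every
    generator [X^a - X^b] glues two disjoint edge sets [C1] and [C2] whose
    spans meet in the line of the common vertex degree [alpha] of [X^a] and [X^b].
    A closed walk alternating between the edges of [a] and those of [b] has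
    vertex degree an integral multiple of [alpha].  A shortest one can be chosen
    of circuit shape; it visits some vertex exactly once, so the multiple is [1],
    and having no shortcut it carries exactly the exponents [a] and [b]. *)

Set Implicit Arguments.
Unset Strict Implicit.
Unset Printing Implicit Defensive.

Import Order.TTheory GRing.Theory Num.Theory.

(** * Splitting dominating families *)

(** Why a quotient can be too large: if at least [#|T|] generators were mixed on [T], the variables
    of [T] and the remaining generators would number at most [m - rank A], so their quotient would
    have dimension at least [rank A]. But this ideal contains the toric ideal and a variable: modulo
    it only those monomials of the edge ring survive that are not divisible by that variable, and
    they fill dimension at most [rank A - 1]. Both statements, and the bound on the height, are
    reached by counting monomials and linearly independent polynomials of bounded degree, in place
    of Krull's height theorem. The splitting sees only the supports of the monomials. The exponents
    come back through the integral lattice [ker A]: in a relation restricted to one side of a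
    partition, the rows inside that side have vertex degree zero, so only an integral multiple of
    [alpha] remains. Integrality matters, because it lets a vertex visited once force the multiple
    to be 1. *)

Lemma uniq_map_inj (T U : eqType) (f : T -> U) s :
  uniq (map f s) -> {in s &, injective f}.
Proof.
elim: s => //= a s ih /andP[na us] x y.
rewrite !inE => /predU1P[->|xs] /predU1P[->|ys] // e; last exact: ih.
  by case/negP: na; rewrite e map_f.
by case/negP: na; rewrite -e map_f.
Qed.

Section Splitting.
Variable E : finType.
Implicit Types (A C D T : {set E}) (r : {set E} * {set E}).
Implicit Types (rows : seq ({set E} * {set E})).

Definition touches A T := A :&: T != set0.

Definition mixed T r := touches r.1 T && touches r.2 T.

Definition rows_in C rows :=
  all (fun r => [&& r.1 != set0, r.2 != set0, r.1 \subset C & r.2 \subset C])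
    rows.

(** Reading a row as a sign pattern, this says that no nonempty square submatrix has a positive and
    a negative entry in each of its rows: the dominating matrices of Fischer and Shapiro. *)
Definition dominating C rows :=
  [forall T : {set E}, (T \subset C) && (T != set0) ==>
     (count (mixed T) rows < #|T|)].

Definition inside D r := (r.1 \subset D) && (r.2 \subset D).

Definition separated C D r :=
  (r.1 \subset D) && (r.2 \subset C :\: D)
  || (r.2 \subset D) && (r.1 \subset C :\: D).

Definition splits C rows := exists r0 D,
  [/\ r0 \in rows, D \subset C, separated C D r0 &
      forall r, r \in rows -> r != r0 -> inside D r || inside (C :\: D) r].

Lemma dominatingP C rows :
  reflect (forall T, T \subset C -> T != set0 -> count (mixed T) rows < #|T|)
          (dominating C rows).
Proof.
apply: (iffP forallP) => [h T TC T0|h T].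
  by move/implyP: (h T); apply; rewrite TC.
by apply/implyP => /andP[]; exact: h.
Qed.

Lemma touchesP A T : reflect (exists2 x, x \in A & x \in T) (touches A T).
Proof.
apply: (iffP (set0Pn _)) => [[x /setIP[]]|[x xA xT]]; first by exists x.
by exists x; rewrite inE xA.
Qed.

Lemma touchesS A T T' : T \subset T' -> touches A T -> touches A T'.
Proof. by move=> sT /touchesP[x xA /(subsetP sT) xT]; apply/touchesP; exists x. Qed.

Lemma mixedS T T' r : T \subset T' -> mixed T r -> mixed T' r.
Proof. by move=> sT /andP[h1 h2]; rewrite /mixed !(touchesS sT). Qed.

Lemma rows_inP C rows r : rows_in C rows -> r \in rows ->
  [/\ r.1 != set0, r.2 != set0, r.1 \subset C & r.2 \subset C].
Proof. by move=> /allP h /h /and4P[]. Qed.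

Lemma dominating_disjoint C rows r x : dominating C rows -> rows_in C rows ->
  r \in rows -> x \in r.1 -> x \in r.2 -> False.
Proof.
move=> /dominatingP dom rin rr x1 x2.
have [_ _ /subsetP s1 _] := rows_inP rin rr.
have := dom [set x]; rewrite sub1set (s1 _ x1) cards1.
have n0 : [set x] != set0 by apply/set0Pn; exists x; rewrite inE.
move=> /(_ isT n0); rewrite ltnS leqn0 => /eqP c0.
suff : has (mixed [set x]) rows by rewrite has_count c0.
by apply/hasP; exists r => //; apply/andP; split; apply/touchesP; exists x;
  rewrite ?inE.
Qed.

(** Two elements [x] and [y] from the two sides of a row form a set that is mixed for every copy of
    this row. *)
Lemma dominating_uniq C rows : dominating C rows -> rows_in C rows -> uniq rows.
Proof.
move=> dom rin; apply: count_mem_uniq => r.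
have [rr|] := boolP (r \in rows); last by move/count_memPn.
have [/set0Pn[x x1] /set0Pn[y y2] /subsetP s1 /subsetP s2] := rows_inP rin rr.
have xy : x != y.
  apply/eqP => xy; apply: (dominating_disjoint dom rin rr x1).
  by rewrite xy.
have := dominatingP _ _ dom [set x; y]; rewrite cards2 xy subUset !sub1set.
rewrite s1 // s2 // => /(_ isT).
have n0 : [set x; y] != set0 by apply/set0Pn; exists x; rewrite !inE eqxx.
move=> /(_ n0) lt2.
have : count_mem r rows <= count (mixed [set x; y]) rows.
  apply: sub_count => _ /eqP->; apply/andP; split; apply/touchesP.
    by exists x; rewrite // !inE eqxx.
  by exists y; rewrite // !inE eqxx orbT.
have : 0 < count_mem r rows by rewrite -has_count has_pred1.
by rewrite /=; lia.
Qed.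

Lemma separatedC C D r : D \subset C ->
  separated C D r -> separated C (C :\: D) r.
Proof.
move=> DC; rewrite /separated setDDr setDv set0U (setIidPr DC).
by rewrite orbC ![(_ \subset D) && _]andbC.
Qed.

Lemma size_dominating C rows : C != set0 -> dominating C rows ->
  rows_in C rows -> size rows < #|C|.
Proof.
move=> C0 /dominatingP dom rin.
have := dom C (subxx _) C0; rewrite (@eq_in_count _ _ predT) ?count_predT //.
move=> r /(rows_inP rin)[n1 n2 s1 s2].
by rewrite /mixed /touches (setIidPl s1) (setIidPl s2) n1 n2.
Qed.

Lemma dominating_sub C C' rows rows' :
  C' \subset C -> (forall T, T \subset C' -> count (mixed T) rows' <= count (mixed T) rows) ->
  dominating C rows -> dominating C' rows'.
Proof.
move=> sC le /dominatingP dom; apply/dominatingP => T TC T0.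
by apply: leq_ltn_trans (le _ TC) (dom _ (subset_trans TC sC) T0).
Qed.

(** * Contracting a row with two singleton sides *)

Section Contraction.
Variables (C : {set E}) (rest : seq ({set E} * {set E})) (j k : E).
Hypothesis jk : j != k.
Let rows := ([set j], [set k]) :: rest.
Hypothesis rin : rows_in C rows.
Hypothesis dom : dominating C rows.

(** The image of [A] when [k] is identified with [j]; [uncontract] takes preimages under this
    identification. *)
Definition contract A := if k \in A then j |: (A :\ k) else A.
Definition contract_row r := (contract r.1, contract r.2).
Definition uncontract T := if j \in T then k |: T else T.

Lemma touches_contract A T : k \notin T ->
  touches (contract A) T = touches A (uncontract T).
Proof.
move=> kT; apply/touchesP/touchesP; rewrite /contract /uncontract.
- case: ifP => kA [x]; last first.
    by move=> xA xT; exists x => //; case: ifP; rewrite // !inE xT orbT.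
  rewrite !inE => /orP[/eqP->|/andP[xk xA]] xT.
    by exists k; rewrite // xT !inE eqxx.
  by exists x => //; case: ifP; rewrite // !inE xT orbT.
- case=> x xA; case: ifP => jT.
    rewrite !inE => /orP[/eqP xk|xT].
      by exists j => //; rewrite -xk xA !inE eqxx.
    exists x => //; case: ifP; rewrite ?xA // !inE => _.
    by rewrite xA andbT; apply/orP; right; apply: contraNneq kT => <-.
  move=> xT; exists x => //; case: ifP; rewrite ?xA // !inE => _.
  by rewrite xA andbT; apply/orP; right; apply: contraNneq kT => <-.
Qed.

Lemma contract_rows_in : rows_in (C :\ k) (map contract_row rest).
Proof.
have [_ _ ] := rows_inP rin (mem_head _ _); rewrite !sub1set => jC kC.
apply/allP => _ /mapP[r rr ->].
have [|n1 n2 s1 s2] := rows_inP rin (r := r); first by rewrite inE rr orbT.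
have ne A : A != set0 -> contract A != set0.
  move=> /set0Pn[x xA]; apply/set0Pn; rewrite /contract.
  by case: ifP => _; [exists j; rewrite !inE eqxx | exists x].
have su A : A \subset C -> contract A \subset C :\ k.
  move=> /subsetP sA; apply/subsetP => x; rewrite /contract.
  case: ifP => kA; rewrite !inE.
    by case/orP=> [/eqP->|/andP[-> /sA->]] //; rewrite jk.
  move=> xA; rewrite sA // andbT; apply/eqP => xk.
  by rewrite -xk xA in kA.
by apply/and4P; split => /=; [exact: ne | exact: ne | exact: su | exact: su].
Qed.

(** If [j] is in [T], pulling back adds the element [k] to [T], but also the row [([set j],
    [set k])] to the mixed rows, so the strict inequality survives. *)
Lemma contract_dominating : dominating (C :\ k) (map contract_row rest).
Proof.
have [_ _ ] := rows_inP rin (mem_head _ _); rewrite !sub1set => jC kC.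
apply/dominatingP => T TC T0.
have kT : k \notin T by apply/negP => /(subsetP TC); rewrite !inE eqxx.
have TC' : T \subset C by apply: subset_trans TC (subsetDl _ _).
rewrite count_map (eq_count (a2 := mixed (uncontract T))); last first.
  by move=> r; rewrite /= /mixed /= !touches_contract.
have := dominatingP _ _ dom (uncontract T); rewrite /uncontract /=.
case: ifP => jT; last first.
  move=> /(_ TC' T0); apply: leq_ltn_trans.
  by rewrite leq_addl.
rewrite subUset sub1set kC TC' cardsU1 kT => /(_ isT).
have n0 : k |: T != set0 by apply/set0Pn; exists k; rewrite !inE eqxx.
move=> /(_ n0).
suff -> : mixed (k |: T) ([set j], [set k]) by clear; lia.
apply/andP; split; apply/touchesP; first by exists j; rewrite !inE ?eqxx ?jT ?orbT.
by exists k; rewrite !inE ?eqxx.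
Qed.

(** In the pulled-back partition [j] and [k] are on the same side, so the contracted row does not
    cross it. *)
Lemma contract_splits : splits (C :\ k) (map contract_row rest) ->
  splits C rows.
Proof.
have [_ _ ] := rows_inP rin (mem_head _ _); rewrite !sub1set => jC kC.
case=> _ [D [/mapP[r0 r0r ->] DC sep oth]].
have uq := dominating_uniq contract_dominating contract_rows_in.
have kD : k \notin D by apply/negP => /(subsetP DC); rewrite !inE eqxx.
pose D' := uncontract D.
have [kj C'D]: ((k \in D') = (j \in D')) /\ (forall x, x != k -> (x \in D') = (x \in D)).
  rewrite /D' /uncontract; case: ifP => jD; split.
  - by rewrite !inE eqxx jD orbT.
  - by move=> x xk; rewrite !inE (negPf xk).
  - by rewrite (negPf kD) jD.
  - by [].
have D'C : D' \subset C.
  apply/subsetP => x; have [->//|xk] := eqVneq x k.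
  by rewrite C'D // => /(subsetP DC); rewrite !inE => /andP[].
have jD' : (j \in D') = (j \in D) by rewrite C'D.
have sD A : contract A \subset D -> A \subset D'.
  move=> /subsetP sA; apply/subsetP => x xA; move: (sA x) (sA j).
  rewrite /contract; case: ifP => kA; rewrite ?inE ?eqxx /=.
    have [->|xk] := eqVneq x k; first by rewrite kj jD' => _; apply.
    by rewrite xA C'D //= orbT => ->.
  by rewrite C'D ?xA; [move->|apply: contraFneq kA => <-].
have sCD A : A \subset C -> contract A \subset (C :\ k) :\: D -> A \subset C :\: D'.
  move=> /subsetP AC /subsetP sA; apply/subsetP => x xA; move: (sA x) (sA j).
  rewrite /contract; case: ifP => kA; rewrite !inE ?eqxx ?(AC x xA) ?andbT /=.
    have [->|xk] := eqVneq x k; first by rewrite kj jD' => _ /(_ isT)/andP[].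
    by rewrite xA C'D //= orbT => /(_ isT)/andP[].
  by rewrite xA C'D; [case/(_ isT)/andP|apply: contraFneq kA => <-].
have sub r : r \in rest -> r.1 \subset C /\ r.2 \subset C.
  by move=> rr; have [|_ _ s1 s2] := rows_inP rin (r := r); rewrite // inE rr orbT.
exists r0, D'; split=> //; first by rewrite inE r0r orbT.
  have [s1 s2] := sub _ r0r.
  by case/orP: sep => /andP[/= h1 h2]; apply/orP; [left|right]; rewrite sD ?sCD.
move=> r; rewrite inE => /orP[/eqP-> _|rr rr0].
  rewrite /inside /= !sub1set !inE jC kC kj.
  by case: (j \in D').
have [s1 s2] := sub _ rr.
have ne : contract_row r != contract_row r0.
  apply: contra rr0 => /eqP eqc.
  by apply/eqP/(uniq_map_inj uq).
by case/orP: (oth _ (map_f _ rr) ne) => /andP[h1 h2]; apply/orP; [left|right];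
  rewrite /inside ?sD ?sCD.
Qed.

End Contraction.

(** * Deleting an element that is not a whole side of any row *)

Section Deletion.
Variables (C : {set E}) (rows : seq ({set E} * {set E})) (j : E).
Hypothesis jC : j \in C.
Hypothesis rin : rows_in C rows.
Hypothesis dom : dominating C rows.
Hypothesis noncritical :
  forall r, r \in rows -> (r.1 != [set j]) && (r.2 != [set j]).

Definition delete_row r := (r.1 :\ j, r.2 :\ j).

Lemma mixed_delete T r : j \notin T -> mixed T (delete_row r) = mixed T r.
Proof.
move=> jT; have h A : touches (A :\ j) T = touches A T.
  apply/touchesP/touchesP => -[x xA xT]; exists x => //.
    by move: xA; rewrite !inE => /andP[].
  by rewrite !inE xA andbT; apply: contraNneq jT => <-.
by rewrite /mixed !h.
Qed.

Lemma delete_rows_in : rows_in (C :\ j) (map delete_row rows).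
Proof.
apply/allP => _ /mapP[r rr ->].
have [n1 n2 s1 s2] := rows_inP rin rr; have /andP[m1 m2] := noncritical rr.
have h A : A != set0 -> A != [set j] -> A :\ j != set0.
  move=> n m; apply: contra m; rewrite setD_eq0 subset1 (negPf n) orbF.
  by [].
by apply/and4P; split=> /=; rewrite ?h ?setSD.
Qed.

Lemma delete_dominating : dominating (C :\ j) (map delete_row rows).
Proof.
apply: dominating_sub dom; first exact: subsetDl.
move=> T TC; rewrite count_map (eq_count (a2 := mixed T)) // => r /=.
by rewrite mixed_delete //; apply/negP => /(subsetP TC); rewrite !inE eqxx.
Qed.

Variables (r0 : {set E} * {set E}).
Hypothesis r0r : r0 \in rows.

Definition side D := [seq r <- rows | (r != r0) && inside D (delete_row r)].

(* [pa] and [pb] are the two sides of [r0], in either order; the auxiliary row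
   [(pa, [set j])] records that [j] must end up away from [pa]. *)
Lemma delete_splits (E1 E2 pa pb : {set E}) :
  (forall C' rows', #|C'| < #|C| -> rows' != [::] -> rows_in C' rows' ->
     dominating C' rows' -> splits C' rows') ->
  E1 :|: E2 = C :\ j -> [disjoint E1 & E2] ->
  pa \subset E1 -> pa != set0 -> pb \subset j |: E2 -> pb :\ j != set0 ->
  (r0 = (pa, pb) \/ r0 = (pb, pa)) ->
  (forall r, r \in rows -> r != r0 ->
     inside E1 (delete_row r) || inside E2 (delete_row r)) ->
  dominating (j |: E1) ((pa, [set j]) :: side E1) ->
  splits C rows.
Proof.
move=> IH EU Edis paE pa0 pbE pb0 r0E oth dom1.
have jE1 : j \notin E1.
  apply/negP => jE; have : j \in C :\ j by rewrite -EU inE jE.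
  by rewrite !inE eqxx.
have sC1 : j |: E1 \subset C.
  rewrite subUset sub1set jC; apply: subset_trans (subsetDl C [set j]).
  by rewrite -EU subsetUl.
have sC2 : j |: E2 \subset C.
  rewrite subUset sub1set jC; apply: subset_trans (subsetDl C [set j]).
  by rewrite -EU subsetUr.
have unD A D : A :\ j \subset D -> A \subset j |: D by rewrite subDset.
have rin1 : rows_in (j |: E1) ((pa, [set j]) :: side E1).
  rewrite /= pa0 sub1set !inE eqxx (subset_trans paE) ?subsetUr //= andbT.
  have -> /= : [set j] != set0 by apply/set0Pn; exists j; rewrite inE.
  apply/allP => r; rewrite mem_filter => /andP[/andP[_ /andP[i1 i2]] rr].
  have [n1 n2 _ _] := rows_inP rin rr.
  by apply/and4P; split=> //; exact: unD.
have E2sub : [disjoint j |: E1 & E2].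
  rewrite disjoints_subset subUset sub1set inE -disjoints_subset Edis andbT.
  apply/negP => jE; have : j \in C :\ j by rewrite -EU inE jE orbT.
  by rewrite !inE eqxx.
have lt1 : #|j |: E1| < #|C|.
  apply: proper_card; rewrite properE sC1 /=; apply/negP => CE.
  case/set0Pn: pb0 => x; rewrite !inE => /andP[xj] /(subsetP pbE).
  rewrite !inE (negPf xj) /= => xE2.
  have : x \in j |: E1 by apply: (subsetP CE); apply: (subsetP sC2); rewrite !inE xE2 orbT.
  by move=> /(disjointFr E2sub); rewrite xE2.
have [k [D [kr DC sep othD]]] := IH _ _ lt1 (isT : (pa, [set j]) :: side E1 != [::]) rin1 dom1.
have uq := dominating_uniq dom1 rin1.
have fromE2 r D' : D' \subset E1 -> r \in rows -> r != r0 -> inside E2 (delete_row r) ->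
    inside (C :\: D') r.
  move=> D'E rr rr0 /andP[/unD i1 /unD i2].
  suff h : j |: E2 \subset C :\: D' by rewrite /inside !(subset_trans _ h).
  rewrite subsetD sC2 /= disjoint_sym disjoints_subset; apply/subsetP => x /(subsetP D'E) xE1.
  rewrite !inE negb_or (disjointFr Edis xE1) andbT.
  by apply: contraNneq jE1 => <-.
have sD' D' : D' \subset E1 -> (j |: E1) :\: D' \subset C :\: D' by move=> _; exact: setSD.
have pbD D' : D' \subset E1 -> pb \subset C :\: D'.
  move=> D'E; apply: subset_trans pbE _.
  rewrite subsetD sC2 /= disjoint_sym disjoints_subset; apply/subsetP => x /(subsetP D'E) xE1.
  rewrite !inE negb_or (disjointFr Edis xE1) andbT.
  by apply: contraNneq jE1 => <-.
have norm D' : D' \subset j |: E1 -> j \notin D' -> D' \subset E1.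
  move=> /subsetP s nj; apply/subsetP => x xD; have := s _ xD.
  by rewrite !inE => /predU1P[xj|//]; rewrite -xj xD in nj.
(* [D] may be exchanged with its complement in [j |: E1]. With [j] outside [D], the complement of
   [D] in [C] absorbs [j] and all of [E2]. *)
wlog jD : D DC sep othD / j \notin D.
  move=> wl; have [jD|jD] := boolP (j \in D); last exact: (wl D).
  apply: (wl ((j |: E1) :\: D)); first exact: subsetDl.
  - exact: separatedC.
  - move=> r rr rk; rewrite setDDr setDv set0U (setIidPr DC) orbC.
    exact: othD.
  - by rewrite !inE jD.
have DE := norm _ DC jD.
have oth1 r : r \in side E1 -> r != k -> inside D r || inside (C :\: D) r.
  move=> rs rk; have := othD r; rewrite inE rs orbT rk => /(_ isT isT).
  case/orP=> [->//|/andP[i1 i2]]; apply/orP; right.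
  by rewrite /inside !(subset_trans _ (sD' _ DE)).
have inS r : r \in rows -> r != r0 -> inside E1 (delete_row r) -> r \in side E1.
  by move=> rr rr0 i1; rewrite mem_filter rr0 i1.
(* If the auxiliary row is the splitting one, [r0] takes its place. Otherwise it keeps [pa] on the
   side of [j], so that [r0] lies inside the complement of [D] and [k] splits [C]. *)
have [kE|kE] := eqVneq k (pa, [set j]).
  have paD : pa \subset D.
    case/orP: sep; rewrite kE /= !sub1set => /andP[] //.
    by rewrite (negPf jD).
  exists r0, D; split=> //; first exact: subset_trans DC sC1.
    by rewrite /separated; case: r0E => -> /=; rewrite paD pbD //= orbT.
  move=> r rr rr0; case/orP: (oth _ rr rr0) => i1; last first.
    by rewrite orbC fromE2.
  apply: oth1; first exact: inS.
  move: uq => /= /andP[nin _]; apply: contra nin => /eqP rk.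
  by rewrite -kE -rk; apply: inS.
have kS : k \in side E1 by move: kr; rewrite inE (negPf kE).
move: (kS); rewrite mem_filter => /andP[/andP[kr0 _] krows].
have paD : pa \subset C :\: D.
  have := othD (pa, [set j]); rewrite mem_head eq_sym kE => /(_ isT isT).
  case/orP=> /andP[/= i1]; first by rewrite sub1set (negPf jD).
  by move=> _; apply: subset_trans i1 (sD' _ DE).
exists k, D; split=> //; first exact: subset_trans DC sC1.
  case/orP: sep => /andP[h1 h2]; apply/orP; [left|right];
  by rewrite h1 (subset_trans h2) ?sD'.
move=> r rr rk; have [->|rr0] := eqVneq r r0.
  apply/orP; right; rewrite /inside.
  by case: r0E => -> /=; rewrite paD pbD.
case/orP: (oth _ rr rr0) => i1; last by rewrite orbC fromE2.
by apply: oth1 => //; exact: inS.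
Qed.

End Deletion.

(** Induction on the size of [C]. A row of two singletons can be contracted; without such a row
    there is an element whose deletion empties no side, and the work is to put it back. *)
Lemma dominating_splits C rows : rows != [::] -> rows_in C rows ->
  dominating C rows -> splits C rows.
Proof.
move: {2}#|C| (leqnn #|C|) => N; elim: N C rows => [|N IHN] C rows leN rn0 rin dom.
  case: rows rn0 rin {dom} => // r rows _ /= /andP[/and4P[/set0Pn[x xr] _ /subsetP s _] _].
  move: leN; rewrite leqn0 cards_eq0 => /eqP C0.
  by have := s _ xr; rewrite C0 inE.
have IH C' rows' : #|C'| < #|C| -> rows' != [::] -> rows_in C' rows' ->
     dominating C' rows' -> splits C' rows'.
  by move=> lt; apply: IHN; rewrite -ltnS (leq_trans lt).
have C0 : C != set0.
  case: rows rn0 rin {dom} => // r rows _ /= /andP[/and4P[/set0Pn[x xr] _ /subsetP s _] _].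
  by apply/set0Pn; exists x; exact: s.
have uq := dominating_uniq dom rin.
have [/hasP[[p q] rr /=]|] := boolP (has (fun r => (#|r.1| == 1) && (#|r.2| == 1)) rows).
  move=> /andP[/cards1P[j pE] /cards1P[k qE]]; subst p q.
  have jk : j != k.
    apply/eqP => jk; apply: (dominating_disjoint dom rin rr (x := j)); rewrite inE //.
    by rewrite jk.
  have pr := perm_to_rem rr; set rest := rem _ rows in pr.
  have rin' : rows_in C (([set j], [set k]) :: rest) by rewrite /rows_in -(perm_all _ pr).
  have dom' : dominating C (([set j], [set k]) :: rest).
    apply/dominatingP => T TC T0; move/permP: pr => <-.
    exact: (dominatingP _ _ dom).
  have : splits C (([set j], [set k]) :: rest).
    have [_ _ ] := rows_inP rin rr; rewrite !sub1set => jC kC.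
    have [rest0|restn] := eqVneq rest [::].
      exists ([set j], [set k]), [set j]; rewrite rest0 !inE eqxx; split=> //.
      - by rewrite sub1set.
      - by rewrite /separated /= subxx sub1set !inE kC eq_sym jk.
      - by move=> r; rewrite inE => ->.
    apply: (contract_splits jk rin' dom'); apply: IH.
    - by rewrite (cardsD1 k C) kC.
    - by rewrite -size_eq0 size_map size_eq0.
    - exact: (contract_rows_in jk rin').
    - exact: contract_dominating dom'.
  case=> r0 [D [r0r DC sep oth]]; exists r0, D; split=> //.
    by rewrite (perm_mem pr).
  by move=> r; rewrite (perm_mem pr) => *; apply: oth.
move=> /hasPn no2.
(* Otherwise each element of [C] would be a full side of some row. No row serves two elements, since
   its sides are not both singletons, so there would be at least [#|C|] rows. *)
have [j jC nc] : exists2 j, j \in C &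
    forall r, r \in rows -> (r.1 != [set j]) && (r.2 != [set j]).
  have [/existsP[j /andP[jC /allP h]]|/existsPn crit] :=
    boolP [exists j, (j \in C) && all (fun r => (r.1 != [set j]) && (r.2 != [set j])) rows].
    by exists j.
  have {}crit j : j \in C -> exists2 r, r \in rows & (r.1 == [set j]) || (r.2 == [set j]).
    move=> jC; have := crit j; rewrite jC => /allPn[r rr].
    by rewrite negb_and !negbK => h; exists r.
  have [rd] : exists rd, rd \in rows.
    by case: (rows) rn0 => // r ? _; exists r; rewrite mem_head.
  move=> _; pose f j := nth rd rows (find (fun r => (r.1 == [set j]) || (r.2 == [set j])) rows).
  have fP j : j \in C -> (f j \in rows) /\ (((f j).1 == [set j]) || ((f j).2 == [set j])).
    move=> jC; have [r rr h] := crit _ jC.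
    have hh : has (fun r => (r.1 == [set j]) || (r.2 == [set j])) rows.
      by apply/hasP; exists r.
    by split; [rewrite mem_nth // -has_find | exact: (nth_find rd hh)].
  have : #|C| <= size rows.
    rewrite cardE -(size_map f); apply: uniq_leq_size; last first.
      by move=> x /mapP[j jC ->]; rewrite mem_enum in jC; have [] := fP _ jC.
    rewrite map_inj_in_uniq ?enum_uniq // => j k; rewrite !mem_enum => jC kC fjk.
    have [fr hj] := fP _ jC; have [_ hk] := fP _ kC; rewrite -fjk in hk.
    have := no2 _ fr; case/orP: hj => /eqP hj; case/orP: hk => /eqP hk.
    - by move=> _; apply: set1_inj; rewrite -hj -hk.
    - by rewrite hj hk !cards1.
    - by rewrite hj hk !cards1.
    - by move=> _; apply: set1_inj; rewrite -hj -hk.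
  by rewrite leqNgt size_dominating.
have ltC : #|C :\ j| < #|C| by rewrite (cardsD1 j C) jC.
have [||_ [D [/mapP[r0 r0r ->] DC sep oth]]] :=
  IH (C :\ j) (map (delete_row j) rows) ltC _ _ (delete_dominating j dom).
- by rewrite -size_eq0 size_map size_eq0.
- exact: delete_rows_in.
have duq := dominating_uniq (delete_dominating j dom) (delete_rows_in rin nc).
pose E2 := (C :\ j) :\: D.
have EU : D :|: E2 = C :\ j.
  apply/setP => x; have := subsetP DC x; rewrite !inE.
  by case: (x \in D) => //= ->.
have Edis : [disjoint D & E2] by rewrite disjoints_subset /E2 setCD subsetUr.
have {}oth r : r \in rows -> r != r0 -> inside D (delete_row j r) || inside E2 (delete_row j r).
  move=> rr rr0; apply: oth; first exact: map_f.
  by apply: contra rr0 => /eqP /(uniq_map_inj duq rr r0r) ->.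
have {sep} : exists E1 E2 pa pb, [/\ E1 :|: E2 = C :\ j /\ [disjoint E1 & E2],
    pa :\ j \subset E1, pb :\ j \subset E2, (r0 = (pa, pb) \/ r0 = (pb, pa)) &
    forall r, r \in rows -> r != r0 -> inside E1 (delete_row j r) || inside E2 (delete_row j r)].
  case/orP: sep => /andP[/= s1 s2].
    by exists D, E2, r0.1, r0.2; split=> //; left; case: (r0).
  by exists D, E2, r0.2, r0.1; split=> //; right; case: (r0).
case=> {EU Edis oth DC}D [{}E2 [pa [pb [[EU Edis] paE pbE r0E oth]]]].
have [pan pbn] : pa :\ j != set0 /\ pb :\ j != set0.
  have [/= n1 n2 _ _] := rows_inP (delete_rows_in rin nc) (map_f _ r0r).
  by case: r0E n1 n2 => ->.
have [pan' pbn'] : pa != set0 /\ pb != set0.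
  by split; [case/set0Pn: pan => x | case/set0Pn: pbn => x]; rewrite !inE => /andP[_ ?];
    apply/set0Pn; exists x.
have dj : ~ (j \in pa /\ j \in pb).
  case=> ja jb; apply: (dominating_disjoint dom rin r0r (x := j));
  by case: r0E => ->.
have subC D' : D' = D \/ D' = E2 -> (j |: D' \subset C) /\ (j \notin D').
  move=> h; have sD' : D' \subset C :\ j by rewrite -EU; case: h => ->; rewrite ?subsetUl ?subsetUr.
  split; first by rewrite subUset sub1set jC (subset_trans sD') ?subsetDl.
  by apply/negP => /(subsetP sD'); rewrite !inE eqxx.
have [sD jD] := subC D (or_introl erefl); have [sE jE] := subC E2 (or_intror erefl).
have noj (A B : {set E}) : j \notin A -> A :\ j \subset B -> A \subset B.
  move=> jA /subsetP s; apply/subsetP => x xA; apply: s; rewrite !inE xA andbT.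
  by apply: contraNneq jA => <-.
have cnt D' T : count (mixed T) (side rows j r0 D') + mixed T r0 <= count (mixed T) rows.
  rewrite (permP (perm_to_rem r0r)) /= addnC leq_add2l rem_filter //.
  rewrite !count_filter; apply: sub_count => r /= /and3P[-> rr0 _].
  exact: rr0.
have {}mix T : mixed T r0 = touches pa T && touches pb T.
  by rewrite /mixed; case: r0E => -> //=; rewrite andbC.
(* When [j] belongs to the other side of [r0], a set mixed for the auxiliary row contains [j] and is
   already mixed for [r0], which the auxiliary row replaces in the count. *)
have domside D' p : D' = D \/ D' = E2 -> (j \in pa /\ p = pb \/ j \in pb /\ p = pa) ->
    dominating (j |: D') ((p, [set j]) :: side rows j r0 D').
  move=> hD hp; have [sC _] := subC _ hD; apply/dominatingP => T TC T0 /=.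
  have := dominatingP _ _ dom T (subset_trans TC sC) T0; have := cnt D' T.
  case: (boolP (mixed T (p, _))) => [|_]; last by clear; lia.
  move=> /andP[/= m1 /touchesP[x]]; rewrite inE => /eqP-> jT.
  suff -> : mixed T r0 by clear; lia.
  by rewrite mix; case: hp => [[jp pE]|[jp pE]]; rewrite -pE m1 ?andbT /=;
    apply/touchesP; exists j.
(* If [j] lies in one side of [r0], the induction is applied to the opposite block extended by [j];
   if it lies in neither, at least one of the two extended blocks is dominating. *)
have [ja|ja] := boolP (j \in pa).
  have jb : j \notin pb by apply/negP => jb; case: dj.
  apply: (@delete_splits C rows j jC rin r0 r0r E2 D pb pa) => //.
  - by rewrite setUC.
  - by rewrite disjoint_sym.
  - exact: noj.
  - by rewrite -subDset.
  - by case: r0E; [right|left].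
  - by move=> r rr rr0; rewrite orbC oth.
  - by apply: domside; [right|left].
have paD := noj _ _ ja paE.
have [|nd] := boolP (dominating (j |: D) ((pa, [set j]) :: side rows j r0 D)).
  apply: (@delete_splits C rows j jC rin r0 r0r D E2 pa pb) => //.
  by rewrite -subDset.
have jb : j \notin pb.
  by apply: contra nd => jb; apply: domside; [left|right].
have pbE2 := noj _ _ jb pbE.
apply: (@delete_splits C rows j jC rin r0 r0r E2 D pb pa) => //.
- by rewrite setUC.
- by rewrite disjoint_sym.
- by rewrite (subset_trans paD) ?subsetUr.
- by case: r0E; [right|left].
- by move=> r rr rr0; rewrite orbC oth.
have tight D' p T : D' = D \/ D' = E2 -> T \subset j |: D' -> T != set0 ->
    ~~ (count (mixed T) ((p, [set j]) :: side rows j r0 D') < #|T|) ->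
    [/\ j \in T, touches p T & #|T| <= (count (mixed T) (side rows j r0 D')).+1].
  move=> hD TD T0; have [sC _] := subC _ hD.
  move: (dominatingP _ _ dom T (subset_trans TD sC) T0) (cnt D' T) => /= H1 H2; move: (H1) (H2).
  case: (boolP (mixed T (p, _))) => [|_]; last by clear; lia.
  move=> /andP[/= m1 /touchesP[x]]; rewrite inE => /eqP-> jT H3 H4 H5.
  by split=> //; move: H5; clear; lia.
(* A tight set on each side, both containing [j], would together with [r0]
   contradict domination of their union. *)
move: nd; rewrite negb_forall => /existsP[T1]; rewrite negb_imply => /andP[/andP[T1D T10]].
move=> /(tight _ _ _ (or_introl erefl) T1D T10)[jT1 mT1 cT1].
apply/dominatingP => T2 T2E T20; apply/negPn/negP.
move=> /(tight _ _ _ (or_intror erefl) T2E T20)[jT2 mT2 cT2].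
have T12 : T1 :&: T2 = [set j].
  apply/setP => x; rewrite !inE; apply/andP/eqP => [[x1 x2]|->//].
  move: (subsetP T1D _ x1) (subsetP T2E _ x2); rewrite !inE.
  by case: eqP => //= _ /(disjointFr Edis) ->.
have := cardsUI T1 T2; rewrite T12 cards1 => cU.
have TU0 : T1 :|: T2 != set0 by apply/set0Pn; exists j; rewrite inE jT1.
have TUC : T1 :|: T2 \subset C.
  by rewrite subUset (subset_trans T1D sD) (subset_trans T2E sE).
have := dominatingP _ _ dom _ TUC TU0.
rewrite (permP (perm_to_rem r0r)) /= rem_filter //.
have -> : mixed (T1 :|: T2) r0.
  by rewrite mix (touchesS _ mT1) ?subsetUl // (touchesS _ mT2) ?subsetUr.
have : count (mixed T1) (side rows j r0 D) + count (mixed T2) (side rows j r0 E2)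
    <= count (mixed (T1 :|: T2)) [seq x <- rows | predC1 r0 x].
  rewrite !count_filter -count_predUI.
  rewrite (@eq_in_count _ (predI _ _) pred0) ?count_pred0 ?addn0.
    apply: sub_count => r /= /orP[] /and3P[m -> _]; rewrite andbT.
      by apply: mixedS m; rewrite subsetUl.
    by apply: mixedS m; rewrite subsetUr.
  move=> r rr /=; apply/negP => /andP[/and3P[_ _ /andP[i1 _]] /and3P[_ _ /andP[i2 _]]].
  have [n1 _ _ _] := rows_inP (delete_rows_in rin nc) (map_f _ rr).
  case/set0Pn: n1 => x xr; move: (subsetP i1 _ xr) (subsetP i2 _ xr).
  by move=> /(disjointFr Edis) ->.
have aux (a b c t1 t2 u : nat) : t1 <= a.+1 -> t2 <= b.+1 -> u + 1 = t1 + t2 ->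
  a + b <= c -> 1 + c < u -> False by clear; lia.
exact: aux cT1 cT2 cU.
Qed.
End Splitting.

(** * Shortest alternating walks *)

Lemma nat_minimum (P : nat -> Prop) :
  (exists k, P k) -> exists2 k, P k & forall k', P k' -> k <= k'.
Proof.
case=> k; elim/ltn_ind: k => k ih Pk.
have [[k' lt Pk']|no] := classic (exists2 k', k' < k & P k'); first exact: ih lt Pk'.
by exists k => // k' Pk'; rewrite leqNgt; apply/negP => lt; case: no; exists k'.
Qed.

Lemma uniqPn_split (T : eqType) (s : seq T) : ~~ uniq s ->
  exists s1 x s2 s3, s = s1 ++ x :: s2 ++ x :: s3.
Proof.
elim: s => //= a s ih; rewrite negb_and negbK => /orP[|/ih[s1 [x [s2 [s3 ->]]]]].
  by move=> /splitPr[p1 p2]; exists [::], a, p1, p2.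
by exists (a :: s1), x, s2, s3.
Qed.

Section AlternatingWalks.
Variable n : nat.
Local Notation node := ('I_n * bool)%type.
Variable g : bool -> rel 'I_n.
Hypothesis g_sym : forall s, ssrbool.symmetric (g s).
Hypothesis g_irr : forall s, irreflexive (g s).
Hypothesis g_disj : forall x y, g true x y -> ~~ g false x y.

Implicit Types (P Q R N : node) (c A B C D L : seq node).

(* A directed cycle for [alt_arc] is a closed walk whose edges alternate between
   the two graphs; the boolean of a node tells which graph is used next. *)
Definition alt_arc : rel node := fun P Q => (Q.2 == ~~ P.2) && g P.2 P.1 Q.1.

(** The same vertex left by the other colour: reading a walk backwards replaces its nodes by their
    flips, see [arc_flip]. *)
Definition flip P : node := (P.1, ~~ P.2).

Definition shortest c := [/\ c != [::], cycle alt_arc c &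
  forall c', c' != [::] -> cycle alt_arc c' -> size c <= size c'].

Lemma flipK : involutive flip.
Proof. by case=> x s; rewrite /flip /= negbK. Qed.

Lemma flip_neq P : flip P != P.
Proof. by apply/eqP => /(congr1 snd) /=; case: P.2. Qed.

Lemma fst_eq P Q : P.1 = Q.1 -> Q = P \/ Q = flip P.
Proof.
case: P Q => x s [y t] /= ->; have [->|st] := eqVneq s t; first by left.
by right; rewrite /flip /=; congr pair; case: s t st => -[].
Qed.

Lemma arc_flip P Q : alt_arc (flip Q) (flip P) = alt_arc P Q.
Proof.
rewrite /alt_arc /flip /=; case: P Q => x s [y t] /=.
by case: s t => -[]; rewrite //= g_sym.
Qed.

Lemma arc_irr P : alt_arc P (flip P) = false.
Proof. by rewrite /alt_arc /flip /= g_irr andbF. Qed.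

Lemma path_flip P C Q : path alt_arc P (rcons C Q) ->
  path alt_arc (flip Q) (rcons (rev (map flip C)) (flip P)).
Proof.
rewrite -map_rev -map_rcons path_map.
rewrite (@eq_path _ (relpre flip alt_arc) (fun x y => alt_arc y x)); last by move=> N M; exact: arc_flip.
by rewrite -(rev_path _ Q) last_rcons belast_rcons rev_cons revK.
Qed.

Lemma path_sign P s : path alt_arc P s -> (last P s).2 = P.2 (+) odd (size s).
Proof.
elim: s P => [|Q s ih] P /=; first by rewrite addbF.
case/andP=> /andP[/eqP QP _] /ih ->; rewrite QP.
by case: P.2; case: odd.
Qed.

Lemma odd_cycle_size c : c != [::] -> cycle alt_arc c -> ~~ odd (size c).
Proof.
case: c => // P c _ /= /path_sign; rewrite last_rcons size_rcons /=.
by case: P.2; case: odd.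
Qed.

Lemma odd_half P A : path alt_arc P (rcons A (flip P)) -> odd (size A).+1 && (2 <= size A).
Proof.
move=> pA; have := path_sign pA; rewrite last_rcons size_rcons /=.
case: A pA => [|Q [|R A]] /=; first by rewrite arc_irr.
  by case: P.2.
by case: P.2; case: odd.
Qed.

Lemma shortest_rot k c : shortest c -> shortest (rot k c).
Proof.
case=> c0 cy mi; split; last by move=> *; rewrite size_rot mi.
  by rewrite -size_eq0 size_rot size_eq0.
by rewrite rot_cycle.
Qed.

Lemma shortest_catC A B : shortest (A ++ B) -> shortest (B ++ A).
Proof. by move=> /(shortest_rot (size A)); rewrite rot_size_cat. Qed.

Lemma shortest_uniq c : shortest c -> uniq c.
Proof.
move=> sc; apply/negPn/negP => /uniqPn_split[s1 [P [s2 [s3 cE]]]].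
move: sc; rewrite cE => /shortest_catC[_ /= cy /(_ (P :: s2) isT)].
move: cy; rewrite -catA /= rcons_path cat_path /= => /and3P[/andP[p1 /andP[a1 _]] _ _].
by rewrite rcons_path p1 a1 /= !size_cat /= !size_cat /= => /(_ isT); lia.
Qed.

(** An arc between nodes of the cycle that is not one of its steps would be a shortcut. *)
Lemma shortest_next c P Q : shortest c -> P \in c -> Q \in c -> alt_arc P Q ->
  next c P = Q.
Proof.
move=> sc Pc; have uc := shortest_uniq sc; have [k q cE] := rot_to Pc.
rewrite -(mem_rot k) -(next_rot k uc) cE inE => /orP[/eqP->|].
  by rewrite /alt_arc; case: P.2.
move: (shortest_rot k sc); rewrite cE => {}sc {cE} /splitPr qE.
case: q / qE sc => q1 q2 [_ cy mi] a.
have := mi (P :: Q :: q2) isT; move: cy => /=.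
rewrite rcons_cat cat_path /= => /and3P[_ _ ->]; rewrite a => /(_ isT).
by rewrite size_cat /=; case: q1 {mi} => [|? ?] /=; [rewrite eqxx|lia].
Qed.

(* The stretch from [flip P] to [flip Q], read backwards, leads from [Q] to [P]
   and closes up the stretch from [P] to [Q]. *)
Lemma not_interleaved P Q A B C D :
  ~ shortest (P :: A ++ Q :: B ++ flip P :: C ++ flip Q :: D).
Proof.
case=> _ cy /(_ (P :: A ++ Q :: rev (map flip C)) isT).
move: cy => /=; rewrite !rcons_cat /= !cat_path /= !rcons_cat /= !cat_path /= !rcons_cat /= !cat_path /=.
case/and5P=> pA aQ pB aP /and3P[pC aC _].
have /path_flip : path alt_arc (flip P) (rcons C (flip Q)) by rewrite rcons_path pC.
rewrite !flipK => ->; rewrite pA aQ /= => /(_ isT).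
by rewrite /= !size_cat /= !size_cat /= ?size_cat /= ?size_cat /= size_rev size_map; lia.
Qed.

Lemma uniq_fst (s : seq node) : uniq s -> (forall N, N \in s -> flip N \notin s) ->
  uniq (map fst s).
Proof.
move=> us nf; rewrite map_inj_in_uniq // => N M Ns Ms /fst_eq[//|ME].
by have := nf _ Ns; rewrite -ME Ms.
Qed.

Lemma pair_split (s : seq node) N : N \in s -> flip N \in s ->
  exists M s1 s2 s3, s = s1 ++ M :: s2 ++ flip M :: s3.
Proof.
move=> /splitPr[p1 p2]; rewrite mem_cat inE (negPf (flip_neq N)) /= => /orP[].
  by move=> /splitPr[q1 q2]; exists (flip N), q1, q2, p2; rewrite flipK -catA.
by move=> /splitPr[q1 q2]; exists N, p1, q1, q2.
Qed.

Lemma not_shared P A A' N : shortest (P :: A ++ flip P :: A') ->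
  N \in A -> flip N \notin A'.
Proof.
move=> sc /splitPr AE; case: A / AE sc => A1 A2 sc; apply/negP => /splitPr AE.
case: A' / AE sc => C D; rewrite -catA /=; exact: not_interleaved.
Qed.

(** A shortest stretch between a node and its flip contains no other such pair, so it repeats no
    vertex; by [odd_half] the closed walk it forms has odd length. *)
Lemma innermost_uniq (Y : seq node) s1 P A s2 : uniq Y -> Y = s1 ++ P :: A ++ flip P :: s2 ->
  (forall t1 Q B t2, Y = t1 ++ Q :: B ++ flip Q :: t2 -> size A <= size B) ->
  uniq (map fst (P :: A)).
Proof.
move=> uY YE mi; have uPA : uniq (P :: A).
  by move: uY; rewrite YE cat_uniq -cat_cons cat_uniq => /and3P[_ _ /and3P[]].
have fPA : flip P \notin P :: A.
  move: uY; rewrite YE cat_uniq -cat_cons cat_uniq => /and3P[_ _ /and3P[_ + _]].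
  by move=> /hasPn; apply; rewrite mem_head.
apply: uniq_fst => // N NA; apply/negP => fNA.
have [] : N \in A /\ flip N \in A.
  move: NA fNA fPA; rewrite !inE => /orP[/eqP->|NA] /orP[/eqP fN|fNA].
  - by rewrite fN eqxx.
  - by rewrite fNA orbT.
  - by rewrite -fN flipK NA orbT.
  - by [].
move=> NA' fNA'; have [M [t1 [t2 [t3 AE]]]] := pair_split NA' fNA'.
have YE' : Y = (s1 ++ P :: t1) ++ M :: t2 ++ flip M :: (t3 ++ flip P :: s2).
  by rewrite YE AE -!catA /= -?catA /= -?catA.
have := mi _ _ _ _ YE'; rewrite AE !size_cat /= ?size_cat /=; lia.
Qed.

Lemma uniq_cat4 (T : eqType) (X Y Z W : seq T) : uniq (X ++ Y ++ Z ++ W) ->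
  [/\ [/\ uniq X, uniq Y, uniq Z & uniq W],
   [/\ forall x, x \in X -> x \in Y -> False, forall x, x \in X -> x \in Z -> False
     & forall x, x \in X -> x \in W -> False] &
   [/\ forall x, x \in Y -> x \in Z -> False, forall x, x \in Y -> x \in W -> False
     & forall x, x \in Z -> x \in W -> False]].
Proof.
rewrite !cat_uniq => /and3P[uX /hasPn h1 /and3P[uY /hasPn h2 /and3P[uZ /hasPn h3 uW]]].
by split; split=> // x xA xB; [have := h1 x | have := h1 x | have := h1 x
  | have := h2 x | have := h2 x | have := h3 x];
  rewrite ?mem_cat xB ?orbT => /(_ isT); rewrite xA.
Qed.

Lemma half_odd_cycle P A : path alt_arc P (rcons A (flip P)) -> uniq (map fst (P :: A)) ->
  odd_cycle_seq (P.1 :: map fst A).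
Proof.
move=> /odd_half/andP[oA sA] uA; apply/and3P; split=> //=.
  by rewrite size_map; exact: oA.
by rewrite size_map.
Qed.

(** A vertex occurs twice only as a node and its flip. Any unwanted meeting of the cycles and the
    path would therefore repeat a node of a shortest cycle or interleave with the pair formed by [P]
    and [flip P]. *)
Lemma barbell_walk P R A L (Q : seq node) :
  shortest ((P :: A) ++ (flip P :: L) ++ (R :: Q) ++ (flip R :: rev (map flip L))) ->
  uniq (map fst (P :: A)) -> uniq (map fst (R :: Q)) ->
  two_odd_cycles_path_walk
    (map fst ((P :: A) ++ (flip P :: L) ++ (R :: Q) ++ (flip R :: rev (map flip L)))).
Proof.
set X := P :: A; set Y := flip P :: L; set Z := R :: Q; set W := flip R :: _.
move=> sc uX uZ; have us := shortest_uniq sc.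
have [[_ uY _ _] [XY XZ XW] [YZ YW ZW]] := uniq_cat4 us.
have LW N : N \in L -> flip N \in W.
  by move=> NL; rewrite inE mem_rev map_f ?orbT.
have PX : P \in X by rewrite mem_head.
have fPY : flip P \in Y by rewrite mem_head.
have RZ : R \in Z by rewrite mem_head.
have fRW : flip R \in W by rewrite mem_head.
have LY N : N \in L -> N \in Y by move=> NL; rewrite inE NL orbT.
have offP N : N.1 = P.1 -> N = P \/ N = flip P by move=> e; apply: fst_eq.
have offR N : N.1 = R.1 -> N = R \/ N = flip R by move=> e; apply: fst_eq.
have [pA pQ] : path alt_arc P (rcons A (flip P)) /\ path alt_arc R (rcons Q (flip R)).
  case: sc => _ cy _; move: cy; rewrite /X /Y /Z /W /=.
  rewrite rcons_cat /= cat_path /= => /and3P[pA aA].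
  rewrite rcons_cat /= cat_path /= => /and3P[_ _].
  rewrite rcons_cat /= cat_path /= => /and3P[pQ aQ _].
  by rewrite !rcons_path pA aA pQ aQ.
have pthE : take (size (P.1 :: rcons (map fst L) R.1)).-1 (P.1 :: rcons (map fst L) R.1)
    = P.1 :: map fst L.
  by rewrite /= size_rcons /= -cats1 take_size_cat.
have rpthE : take (size (P.1 :: rcons (map fst L) R.1)).-1
    (rev (P.1 :: rcons (map fst L) R.1)) = R.1 :: rev (map fst L).
  rewrite rev_cons rev_rcons /= size_rcons /= -cats1 take_size_cat //.
  by rewrite size_rev.
exists P.1, R.1, (map fst A), (map fst Q), (P.1 :: rcons (map fst L) R.1); split.
- rewrite pthE rpthE !map_cat /=; congr (_ :: _ ++ _ :: _ ++ _ :: _ ++ _ :: _).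
  by rewrite map_rev; congr rev; rewrite -map_comp.
- split; [exact: half_odd_cycle | exact: half_odd_cycle|].
  move=> x; rewrite -!(map_cons fst).
  move=> /mapP[N NX ->]; apply/negP => /mapP[M MZ /fst_eq[ME|ME]].
    by apply: (XZ N); rewrite // -ME.
  move: NX; rewrite inE => /orP[/eqP NP|NA].
    by apply: (YZ M) => //; rewrite ME NP.
  have : flip N \notin L ++ Z ++ W.
    by apply: (@not_shared P A); rewrite // /W -/Z.
  by rewrite !mem_cat -ME MZ orbT.
- split=> //; last by rewrite /= last_rcons.
    rewrite /= mem_rcons rcons_uniq inE negb_or.
    have uL : uniq L by case/andP: uY.
    apply/andP; split; [apply/andP; split|apply/andP; split].
    + apply/eqP => /offR[] PR; first by apply: (XZ P) => //; rewrite PR.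
      by apply: (XW P) => //; rewrite PR.
    + apply/mapP => -[N NL] /esym/offP[] NE; first by apply: (XY P) => //; rewrite -NE LY.
      by case/andP: uY; rewrite -NE NL.
    + apply/mapP => -[N NL] /esym/offR[] NE; first by apply: (YZ R) => //; rewrite -NE LY.
      by apply: (YW (flip R)) => //; rewrite -NE LY.
    + apply: uniq_fst => // N NL; apply/negP => fNL.
      by apply: (YW (flip N)); [exact: LY | exact: LW].
  by rewrite /= size_rcons.
- split=> x; rewrite inE mem_rcons inE => /or3P[/eqP->//|/eqP->//|/mapP[N NL ->]].
  + rewrite -map_cons => /mapP[M MX /esym/offR[] ME].
      by case: (XZ M) => //; rewrite ME.
    by case: (XW M) => //; rewrite ME.
  + rewrite -map_cons => /mapP[M MX /fst_eq[] ME].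
      by case: (XY M) => //; rewrite ME; exact: LY.
    by case: (XW M) => //; rewrite ME; exact: LW.
  + rewrite -map_cons => /mapP[M MZ /esym/offP[] ME].
      by case: (XZ M) => //; rewrite ME.
    by case: (YZ M) => //; rewrite ME.
  + rewrite -map_cons => /mapP[M MZ /fst_eq[] ME].
      by case: (YZ M) => //; rewrite ME; exact: LY.
    by case: (ZW M) => //; rewrite ME; exact: LW.
Qed.

Lemma exists_shortest : (exists c, c != [::] /\ cycle alt_arc c) -> exists c, shortest c.
Proof.
case=> c0 [c00 cy0].
have [|k [c [cE c0' cy]] mi] := @nat_minimum (fun k => exists c, [/\ size c = k, c != [::] & cycle alt_arc c]).
  by exists (size c0), c0.
by exists c; split=> // c' c'0 cy'; rewrite cE mi //; exists c'.
Qed.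

(** Iterating a chosen successor inside the finite set [W] must loop. *)
Lemma exists_cycle (W : pred node) P0 : W P0 ->
  (forall P, W P -> exists2 Q, W Q & alt_arc P Q) -> exists c, c != [::] /\ cycle alt_arc c.
Proof.
move=> WP0 nxt; pose f P := odflt P [pick Q | W Q && alt_arc P Q].
have fP P : W P -> W (f P) && alt_arc P (f P).
  move=> WP; rewrite /f; case: pickP => [Q //|no].
  by have [Q WQ aQ] := nxt _ WP; have := no Q; rewrite WQ aQ.
have Wi i : W (iter i f P0) by elim: i => // i /fP /andP[].
have /trajectP[i lti iE] := looping_order f P0.
exists (traject f (iter i f P0) (fingraph.order f P0 - i)); split.
  by rewrite -size_eq0 size_traject subn_eq0 -ltnNge.
have : 0 < fingraph.order f P0 - i by rewrite subn_gt0.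
case kE : (_ - _) => [//|k] _.
have aux Q j : (forall l, W (iter l f Q)) -> path alt_arc Q (traject f (f Q) j).
  elim: j Q => //= j ih Q hW; have /andP[_ ->] := fP _ (hW 0); rewrite ih // => l.
  by rewrite -iterSr.
rewrite /= rcons_path aux /=; last by move=> l; rewrite -iterD.
rewrite last_traject -iterD.
suff -> : iter i f P0 = f (iter (k + i) f P0) by have /andP[] := fP _ (Wi (k + i)).
rewrite -iE -iterS; congr iter; move: kE; clear; lia.
Qed.

(** Without a node whose flip also occurs, the walk is an even cycle. Otherwise an innermost pair
    bounds an odd cycle, and the rest is a second odd cycle or can be exchanged for a path to an odd
    cycle and back. The node without flip is a vertex visited once, which later fixes the multiple
    of the common degree. *)
Lemma shortest_circuit c0 : shortest c0 -> exists c,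
  [/\ shortest c, exists2 N, N \in c & flip N \notin c &
   [\/ even_cycle_walk (map fst c), two_odd_cycles_vertex_walk (map fst c)
     | two_odd_cycles_path_walk (map fst c)]].
Proof.
move=> sc0.
have [nof|] := boolP (all (fun N => flip N \notin c0) c0).
  exists c0; split=> //.
    by case: (c0) sc0 nof => [[]//|N c _ /andP[h _]]; exists N; rewrite // mem_head.
  constructor 1; case: (sc0) => c00 cy _; apply/and3P; split.
  - apply: uniq_fst; [exact: shortest_uniq|exact/allP].
  - by rewrite size_map odd_cycle_size.
  (* A cycle of length 2 would join the same two vertices in both colours. *)
  - have := odd_cycle_size c00 cy; rewrite size_map.
    case: (c0) c00 cy => [|P [|Q [|R c]]] //= _ /and3P[/andP[/eqP e1 a1] /andP[/eqP e2 a2] _] _.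
    move: a1 a2; rewrite e1 g_sym.
    by case: P.2 => a1 a2; [have := g_disj a1|have := g_disj a2]; rewrite ?a1 ?a2.
case/allPn => N Nc0; rewrite negbK => fNc0.
have [M [s1 [s2 [s3 c0E]]]] := pair_split Nc0 fNc0.
(* The minimum ranges over all shortest cycles, so that it also covers the rotations of [c] that
   start at another pair. *)
have [|k [c [P [A [A' [sc cE <-]]]]] mi] := @nat_minimum (fun k => exists c P A A',
    [/\ shortest c, c = P :: A ++ flip P :: A' & size A = k]).
  exists (size s2), (M :: s2 ++ flip M :: s3 ++ s1), M, s2, (s3 ++ s1); split=> //.
  move: sc0; rewrite c0E => /shortest_catC; by rewrite /= -catA /=.
have uc := shortest_uniq sc.
have uX : uniq (map fst (P :: A)).
  apply: (@innermost_uniq c [::] P A A') => // t1 Q B t2 cE'; apply: mi.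
  exists (Q :: B ++ flip Q :: t2 ++ t1), Q, B, (t2 ++ t1); split=> //.
  move: sc; rewrite cE' => /shortest_catC; by rewrite /= -catA /=.
have [pA pA'] : path alt_arc P (rcons A (flip P)) /\ path alt_arc (flip P) (rcons A' P).
  case: (sc) => _ cy _; move: cy; rewrite cE /= rcons_cat /= cat_path /=.
  by move=> /and3P[h1 h2 h3]; rewrite rcons_path h1 h2 h3.
have [N0 N0A] : exists N0, N0 \in A.
  have := odd_half pA; case: (A) => [|N0 B] //= _; exists N0; exact: mem_head.
(* A vertex of the innermost odd cycle other than [P.1] does not recur on that cycle, nor, by
   [not_shared], on the rest of the walk. *)
have once d B : shortest d -> d = P :: A ++ flip P :: B -> exists2 N, N \in d & flip N \notin d.
  move=> sd dE; exists N0; first by rewrite dE inE mem_cat N0A orbT.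
  have ud := shortest_uniq sd; rewrite dE in ud.
  have N0P : N0 != P by move: ud => /=; rewrite mem_cat => /andP[+ _]; apply: contra => /eqP <-; rewrite N0A.
  have N0fP : N0 != flip P.
    move: ud; rewrite -cat_cons cat_uniq => /and3P[_ /hasPn/(_ (flip P))]; rewrite mem_head.
    by move=> /(_ isT) + _; apply: contra => /eqP <-; rewrite inE N0A orbT.
  rewrite dE inE mem_cat inE !negb_or; apply/and4P; split.
  - by apply: contra N0fP => /eqP <-; rewrite flipK.
  - apply/negP => fN; have := flip_neq N0; rewrite (uniq_map_inj uX (x := flip N0) (y := N0)) ?eqxx //.
      by rewrite inE fN orbT.
    by rewrite inE N0A orbT.
  - by apply: contra N0P => /eqP /(can_inj flipK) ->.
  - by rewrite dE in sd; apply: not_shared sd N0A.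
have [nof|] := boolP (all (fun N => flip N \notin A') A').
  exists c; split=> //; first exact: once cE.
  constructor 2; exists P.1, (map fst A), (map fst A').
  have uY : uniq (flip P :: A').
    by move: uc; rewrite cE -cat_cons cat_uniq => /and3P[].
  have PA' : P \notin A'.
    by move: uc; rewrite cE /= mem_cat inE !negb_or => /andP[/and3P[]].
  have uY' : uniq (map fst (flip P :: A')).
    apply: uniq_fst => // N1; rewrite inE => /orP[/eqP->|N1A].
      by rewrite flipK inE eq_sym (negPf (flip_neq P)).
    rewrite inE negb_or (allP nof _ N1A) andbT; apply: contra PA' => /eqP/(can_inj flipK) <-.
    exact: N1A.
  split.
  - by rewrite cE /= map_cat.
  - exact: half_odd_cycle.
  - by apply: (@half_odd_cycle (flip P)); rewrite ?flipK.
  - move=> x; rewrite inE => /orP[/eqP->//|/mapP[M0 MA ->]].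
    rewrite inE => /orP[/eqP->//|/mapP[R RA' /fst_eq[RE|RE]]].
      move: uc; rewrite cE -cat_cons cat_uniq => /and3P[_ /hasPn/(_ R)].
      by rewrite !inE RA' RE MA !orbT => /(_ isT).
    by have sc' := sc; rewrite cE in sc'; have := not_shared sc' MA; rewrite -RE RA'.
case/allPn => {M s1 s2 s3 c0E} M MA'; rewrite negbK => fMA'.
have [M' [t1 [t2 [t3 A'E]]]] := pair_split MA' fMA'.
have [|l [P1 [R [Q [P2 [AE sQ]]]]] miQ] := @nat_minimum (fun k => exists t1 R (Q : seq node) t2,
    A' = t1 ++ R :: Q ++ flip R :: t2 /\ size Q = k).
  by exists (size t2), t1, M', t2, t3.
have uA' : uniq A' by move: uc; rewrite cE -cat_cons cat_uniq => /and3P[_ _ /andP[]].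
have uZ : uniq (map fst (R :: Q)).
  apply: (@innermost_uniq A' P1 R Q P2) => // u1 S B u2 AE'.
  by rewrite sQ; apply: miQ; exists u1, S, B, u2.
have [pP1 pQ pP2] : [/\ path alt_arc (flip P) (rcons P1 R), path alt_arc R (rcons Q (flip R))
    & path alt_arc (flip R) (rcons P2 P)].
  move: pA'; rewrite AE rcons_cat /= cat_path /= => /and3P[h1 h2].
  rewrite rcons_cat /= cat_path /= => /and3P[h3 h4 h5].
  by rewrite !rcons_path h1 h2 h3 h4 -rcons_path.
(* Of the two connections between the odd cycles, the shorter one is walked in both directions; the
   new cycle is no longer than [c], hence again shortest. *)
have [L [pL sL]] : exists L, path alt_arc (flip P) (rcons L R) /\ (size L).*2 <= size P1 + size P2.
  have [le|lt] := leqP (size P1) (size P2); first by exists P1; split=> //; move: le; clear; lia.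
  exists (rev (map flip P2)); split; last by rewrite size_rev size_map; move: lt; clear; lia.
  by have := path_flip pP2; rewrite flipK.
have fpL := path_flip pL; rewrite flipK in fpL.
pose d := (P :: A) ++ (flip P :: L) ++ (R :: Q) ++ (flip R :: rev (map flip L)).
have sd : shortest d.
  case: sc => _ _ mic; split=> //.
    move: pA pQ pL; rewrite !rcons_path => /andP[h1 h2] /andP[h3 h4] /andP[h5 h6].
    rewrite /d /= rcons_cat cat_path /= h1 h2 rcons_cat cat_path /= h5 h6.
    by rewrite rcons_cat cat_path /= h3 h4.
  move=> c' c'0 cy'; apply: leq_trans (mic _ c'0 cy').
  rewrite cE AE /d /= !size_cat /= !size_cat /= !size_cat /= size_rev size_map.
  by rewrite !ltnS; move: sL; clear; lia.
exists d; split=> //; first exact: (once d (L ++ (R :: Q) ++ (flip R :: rev (map flip L)))).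
by constructor 3; apply: barbell_walk.
Qed.

End AlternatingWalks.

(** * Gluing binomials are circuits *)

Lemma map_next (T : eqType) (c : seq T) : uniq c -> map (next c) c = rot 1 c.
Proof.
case: c => // y p up; apply: (@eq_from_nth _ y) => [|i]; first by rewrite size_map size_rot.
rewrite size_map => lti; rewrite (nth_map y) // next_nth mem_nth // index_uniq //.
rewrite rot1_cons nth_rcons; case: ltnP => // le.
by rewrite nth_default //; case: ifP.
Qed.

Lemma mnm_neq0 m (u : 'X_{1..m}) : u != 0%MM -> exists e, u e != 0.
Proof.
move=> u0; apply/existsP; rewrite -negb_forall; apply: contra u0 => /forallP h.
by apply/eqP/mnmP => e; rewrite mnm0E; apply/eqP.
Qed.

(** * Vertex degrees of monomials *)

Section VertexDegree.
Variables (n m : nat) (ends : 'I_m -> 'I_n * 'I_n).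
Implicit Types u v : 'X_{1..m}.

Definition incidence (e : 'I_m) (x : 'I_n) : nat :=
  ((ends e).1 == x) + ((ends e).2 == x).

Definition vdeg (u : 'X_{1..m}) (x : 'I_n) : nat := \sum_e u e * incidence e x.

Definition msupport (u : 'X_{1..m}) : {set 'I_m} := [set e | u e != 0].

Lemma vdegD u v x : vdeg (u + v)%MM x = vdeg u x + vdeg v x.
Proof. by rewrite /vdeg -big_split /=; apply: eq_bigr => e _; rewrite mnmDE mulnDl. Qed.

Lemma vdegU e x : vdeg U_(e)%MM x = incidence e x.
Proof.
rewrite /vdeg (bigD1 e) //= mnm1E eqxx mul1n big1 ?addn0 // => f fe.
by rewrite mnm1E eq_sym (negPf fe).
Qed.

Lemma vdeg0 x : vdeg 0%MM x = 0.
Proof. by rewrite /vdeg big1 // => e _; rewrite mnm0E. Qed.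

Lemma vdeg_sum (T : Type) (r : seq T) (Q : pred T) (F : T -> 'X_{1..m}) x :
  vdeg (\sum_(i <- r | Q i) F i)%MM x = \sum_(i <- r | Q i) vdeg (F i) x.
Proof.
by elim/big_rec2: _ => [|i y1 y2 _ <-]; rewrite ?vdeg0 ?vdegD.
Qed.

Lemma sum_vdeg u : \sum_x vdeg u x = (mdeg u).*2.
Proof.
rewrite exchange_big /= mdegE -muln2 big_distrl /=; apply: eq_bigr => e _.
rewrite -big_distrr /= /incidence big_split /=; congr (_ * _).
have h (z : 'I_n) : \sum_(x < n) ((z == x) : nat) = 1.
  rewrite (bigD1 z) //= eqxx big1 // => x xz; apply/eqP; rewrite eqb0 eq_sym.
  exact: xz.
by rewrite !h.
Qed.

Lemma eq_vdeg_mdeg u v : vdeg u =1 vdeg v -> mdeg u = mdeg v.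
Proof. by move=> h; apply: double_inj; rewrite -!sum_vdeg; apply: eq_bigr. Qed.

Lemma lem_mdeg_eq (u v : 'X_{1..m}) : (u <= v)%MM -> mdeg u = mdeg v -> u = v.
Proof.
move=> le dE; have := mdegD (v - u)%MM u; rewrite submK // -dE => h.
have : mdeg (v - u)%MM == 0 by move: h; clear; lia.
by rewrite mdeg_eq0 -[v in RHS](submK le) => /eqP ->; rewrite add0m.
Qed.

Lemma vdeg_gt0P u x :
  reflect (exists2 e, u e != 0 & incidence e x != 0) (vdeg u x != 0).
Proof.
rewrite /vdeg sum_nat_eq0 negb_forall; apply: (iffP existsP) => -[e].
  by rewrite /= muln_eq0 negb_or => /andP[]; exists e.
by move=> h1 h2; exists e; rewrite /= muln_eq0 negb_or h1.
Qed.

Hypothesis simple : simple_graph ends.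

Lemma incidence_joins e x y z : edge_joins ends e x y ->
  incidence e z = (x == z) + (y == z).
Proof. by rewrite /incidence => /orP[]/eqP-> //=; rewrite addnC. Qed.

Lemma joinsC e x y : edge_joins ends e x y = edge_joins ends e y x.
Proof. by rewrite /edge_joins orbC. Qed.

Lemma joins_inj e f x y : edge_joins ends e x y -> edge_joins ends f x y -> e = f.
Proof.
by move=> je jf; apply: simple.2; case/orP: je => /eqP-> /=; rewrite // joinsC.
Qed.

Lemma joins_neq e x y : edge_joins ends e x y -> x != y.
Proof. by have := simple.1 e; move=> h /orP[]/eqP E; rewrite E /= in h; rewrite // eq_sym. Qed.

Lemma incidence_neq0 e x : incidence e x != 0 -> exists y, edge_joins ends e x y.
Proof.
rewrite /incidence /edge_joins; case: (ends e) => y z /=.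
have [->|_] := eqVneq y x; first by exists z; rewrite eqxx.
by have [->|//] := eqVneq z x; exists y; rewrite eqxx orbT.
Qed.

Section Gluing.
Variables (C1 C2 : {set 'I_m}) (a b : 'X_{1..m}) (e0 : 'I_m).
Hypothesis Cdis : [disjoint C1 & C2].
Hypothesis sa : msupport a \subset C1.
Hypothesis sb : msupport b \subset C2.
Hypothesis ab_deg : vdeg a =1 vdeg b.
Hypothesis rank1 : forall u v, msupport u \subset C1 -> msupport v \subset C2 ->
  vdeg u =1 vdeg v -> exists t : int, forall x, (Posz (vdeg u x) = t * Posz (vdeg a x))%R.

Let ab s := if s then a else b.

Definition colour_rel s : rel 'I_n :=
  fun x y => [exists e, (ab s e != 0) && edge_joins ends e x y].

Local Notation carc := (alt_arc colour_rel).
Local Notation shortest := (shortest colour_rel).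

Definition colour_edge s x y : 'I_m :=
  odflt e0 [pick e | (ab s e != 0) && edge_joins ends e x y].

Lemma colour_sym s : ssrbool.symmetric (colour_rel s).
Proof. by move=> x y; apply: eq_existsb => e; rewrite joinsC. Qed.

Lemma colour_irr s : irreflexive (colour_rel s).
Proof. by move=> x; apply/existsP => -[e /andP[_ /joins_neq]]; rewrite eqxx. Qed.

Lemma colour_disj x y : colour_rel true x y -> ~~ colour_rel false x y.
Proof.
move=> /existsP[e /andP[ae je]]; apply/existsP => -[f /andP[bf jf]].
have ef := joins_inj je jf; have eC1 : e \in C1 by apply: (subsetP sa); rewrite inE.
have fC2 : f \in C2 by apply: (subsetP sb); rewrite inE.
by move: (disjointFr Cdis eC1); rewrite ef fC2.
Qed.

Lemma colour_edgeP s x y : colour_rel s x y ->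
  (ab s (colour_edge s x y) != 0) && edge_joins ends (colour_edge s x y) x y.
Proof.
move=> /existsP[e he]; rewrite /colour_edge; case: pickP => [//|no].
by have := no e; rewrite he.
Qed.

Lemma vdeg_ab s : vdeg (ab s) =1 vdeg a.
Proof. by move=> x; case: s => //=; rewrite ab_deg. Qed.

Section Cycle.
Variable c : seq ('I_n * bool).
Hypothesis sc : shortest c.
Hypothesis once : exists2 N, N \in c & flip N \notin c.

Let node_edge (N : 'I_n * bool) := colour_edge N.2 N.1 (next c N).1.

Definition colour_part s : 'X_{1..m} := (\sum_(N <- c | N.2 == s) U_(node_edge N))%MM.

Lemma node_edgeP N : N \in c ->
  (ab N.2 (node_edge N) != 0) && edge_joins ends (node_edge N) N.1 (next c N).1.
Proof.
move=> Nc; case: sc => _ cy _; have /andP[_] := next_cycle cy Nc.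
exact: colour_edgeP.
Qed.

Lemma next_sign N : N \in c -> (next c N).2 = ~~ N.2.
Proof. by move=> Nc; case: sc => _ cy _; have /andP[/eqP] := next_cycle cy Nc. Qed.

(** Each visit of [x] uses one edge of either colour, one to arrive and one to leave, so both colour
    parts have the number of visits as their degree. *)
Lemma vdeg_colour_part s x : vdeg (colour_part s) x = count_mem x (map fst c).
Proof.
rewrite vdeg_sum /=.
have -> : \sum_(N <- c | N.2 == s) vdeg U_(node_edge N)%MM x =
   \sum_(N <- c | N.2 == s) (N.1 == x) + \sum_(N <- c | N.2 == s) ((next c N).1 == x).
  rewrite -big_split /= big_seq_cond [RHS]big_seq_cond; apply: eq_bigr => N /andP[Nc _].
  by rewrite vdegU (incidence_joins _ (proj2 (andP (node_edgeP Nc)))).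
have -> : \sum_(N <- c | N.2 == s) ((next c N).1 == x : nat) =
    \sum_(N <- c | N.2 == ~~ s) (N.1 == x : nat).
  transitivity (\sum_(N <- c | (next c N).2 == ~~ s) ((next c N).1 == x : nat)).
    rewrite big_seq_cond [RHS]big_seq_cond; apply: eq_bigl => N.
    by case Nc : (N \in c) => //=; rewrite next_sign // (inj_eq negb_inj).
  rewrite -(big_map (next c) (fun N => N.2 == ~~ s) (fun N => (N.1 == x : nat))).
  rewrite map_next; last exact: (shortest_uniq sc).
  by apply: perm_big; rewrite perm_rot.
rewrite count_map -sum1_count big_mkcond /= [X in _ + X]big_mkcond -big_split /=.
rewrite [RHS]big_mkcond; apply: eq_bigr => -[y t] _ /=.
by case: s t => -[] /=; case: eqP.
Qed.

Lemma msupport_colour_part s : msupport (colour_part s) \subset msupport (ab s).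
Proof.
apply/subsetP => e; rewrite !inE mnm_sumE => h.
suff [N /andP[Nc /eqP Ns] eE] : exists2 N, (N \in c) && (N.2 == s) & node_edge N = e.
  by have /andP[+ _] := node_edgeP Nc; rewrite Ns eE.
apply: NNPP => no; case/eqP: h; rewrite big_seq_cond big1 // => N NN.
by rewrite mnm1E; apply/eqP; rewrite eqb0; apply/eqP => eE; case: no; exists N; rewrite // andbC.
Qed.

(** The two colour parts have equal degrees, so [rank1] makes this degree an integral multiple of
    that of [a]; at the vertex visited once the product is 1, hence so is the multiplier. *)
Lemma vdeg_colour_part_ab s : vdeg (colour_part s) =1 vdeg (ab s).
Proof.
have [t tE] := rank1 (subset_trans (msupport_colour_part true) sa)
  (subset_trans (msupport_colour_part false) sb)
  (fun x => etrans (vdeg_colour_part true x) (esym (vdeg_colour_part false x))).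
have [N Nc fNc] := once.
have c1 : vdeg (colour_part true) N.1 = 1.
  rewrite vdeg_colour_part count_map; have uc := shortest_uniq sc.
  rewrite (@eq_in_count _ _ (pred1 N)) ?count_uniq_mem ?Nc // => M Mc /=.
  apply/eqP/eqP => [/esym/fst_eq[//|ME]|->//].
  by rewrite -ME Mc in fNc.
have := tE N.1; rewrite c1 => t1; have {}t1 : t = 1%R.
  move: t1; clear; case: t => t; last by rewrite NegzE mulNr -PoszM; lia.
  by move/eqP; rewrite -PoszM eqz_nat eq_sym muln_eq1 => /andP[/eqP->].
by move=> x; rewrite vdeg_ab; have := tE x; rewrite t1 mul1r => -[<-]; rewrite !vdeg_colour_part.
Qed.

(** An edge is used at most once in each direction. If [e], joining [x] and [y], were used twice
    with exponent at most 1 in [ab s], equality of degrees at [x] would give another edge [f] of the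
    same colour from [x] to a visited vertex [z], and [f] would be a shortcut. *)
Lemma colour_part_le s : (colour_part s <= ab s)%MM.
Proof.
have uc := shortest_uniq sc.
apply/mnm_lepP => e; have [h|h] := boolP (colour_part s e <= 1).
  apply: leq_trans (_ : (colour_part s e != 0) <= _); first by move: h; clear; lia.
  case: (boolP (_ != 0)) => // h0; rewrite lt0n.
  by have := subsetP (msupport_colour_part s) e; rewrite !inE => ->.
have cE : colour_part s e = count (fun N => (N.2 == s) && (node_edge N == e)) c.
  rewrite mnm_sumE -sum1_count big_mkcond [RHS]big_mkcond; apply: eq_bigr => N _.
  by rewrite mnm1E; case: (N.2 == s) => //=; case: eqP.
have [[x y] eE] : exists p, ends e = p by exists (ends e).
have jxy : edge_joins ends e x y by rewrite /edge_joins eE eqxx.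
have inxy N : N \in c -> N.2 == s -> node_edge N == e ->
    (N.1 = x /\ (next c N).1 = y) \/ (N.1 = y /\ (next c N).1 = x).
  move=> Nc _ /eqP Ne; have /andP[_] := node_edgeP Nc; rewrite Ne /edge_joins eE.
  by case/orP=> /eqP[-> ->]; [left|right].
pose Q N := (N.2 == s) && (node_edge N == e).
have fs N : N \in filter Q c -> [/\ N \in c, N.2 = s &
    (N.1 = x /\ (next c N).1 = y) \/ (N.1 = y /\ (next c N).1 = x)].
  by rewrite mem_filter => /andP[/andP[Ns Ne] Nc]; split=> //; [exact/eqP|exact: inxy].
have le2 : colour_part s e <= 2.
  rewrite cE -size_filter -[2]/(size [:: (x, s); (y, s)]); apply: uniq_leq_size.
    exact: filter_uniq.
  move=> [z t] /fs[_ /= -> [[-> _]|[-> _]]]; rewrite !inE eqxx // orbT //.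
have [N [M [Nf Mf NM]]] : exists N M, [/\ N \in filter Q c, M \in filter Q c & N != M].
  have := filter_uniq Q uc; move: h; rewrite cE -size_filter -/Q.
  case: (filter Q c) => [|N [|M r]] //= _; rewrite inE negb_or => /andP[/andP[NM _] _].
  by exists N, M; rewrite !inE !eqxx orbT.
have [Nc Ns Nxy] := fs _ Nf; have [Mc Ms Mxy] := fs _ Mf.
have {}NM : N.1 != M.1.
  apply: contra NM => /eqP NM; apply/eqP; rewrite [N]surjective_pairing [M]surjective_pairing.
  by rewrite NM Ns Ms.
wlog [Nx My] : N M Nf Mf Nc Mc Ns Ms Nxy Mxy NM / N.1 = x /\ M.1 = y.
  move=> wl; case: (Nxy) (Mxy) => -[N1 _] [[M1 _]|[M1 _]].
  - by rewrite N1 M1 eqxx in NM.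
  - exact: (wl N M).
  - by apply: (wl M N); rewrite // eq_sym.
  - by rewrite N1 M1 eqxx in NM.
have xy : x != y by rewrite -Nx -My.
have [nN nM] : next c N = (y, ~~ s) /\ next c M = (x, ~~ s).
  have := next_sign Nc; have := next_sign Mc.
  rewrite [next c N]surjective_pairing [next c M]surjective_pairing Ns Ms /= => -> ->.
  case: Nxy => -[N1 ->]; last by rewrite -Nx N1 eqxx in xy.
  by case: Mxy => -[M1 ->] //; rewrite -My M1 eqxx in xy.
apply: leq_trans le2 _; rewrite leqNgt; apply/negP => lt2.
have vx : 2 <= vdeg (ab s) x.
  rewrite -(vdeg_colour_part_ab s) vdeg_colour_part -[2]/(size [:: x; x]).
  rewrite count_map -size_filter -[size _]/(size [:: N; flip N]).
  apply: uniq_leq_size; first by rewrite /= inE eq_sym flip_neq.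
  move=> R; rewrite !inE mem_filter => /orP[]/eqP-> /=; rewrite Nx eqxx //=.
  by have := mem_next c M; rewrite Mc nM /flip Nx Ns.
have [f fe] : exists2 f, f != e & ab s f * incidence f x != 0.
  apply: NNPP => no; move: vx; rewrite /vdeg (bigD1 e) //= big1 ?addn0.
    rewrite (incidence_joins _ jxy) eqxx eq_sym (negPf xy) addn0 muln1.
    by rewrite leqNgt lt2.
  move=> f fe; apply/eqP/negPn/negP => h0; case: no; by exists f.
rewrite muln_eq0 negb_or => /andP[abf /incidence_neq0[z jxz]].
have zy : z != y.
  by apply: contra fe => /eqP zy; apply/eqP/(joins_inj jxz); rewrite zy.
have gxz : colour_rel s x z by apply/existsP; exists f; rewrite abf.
have : vdeg (ab s) z != 0.
  by apply/vdeg_gt0P; exists f; rewrite // (incidence_joins _ jxz) eqxx addn1.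
rewrite -(vdeg_colour_part_ab s) vdeg_colour_part -lt0n -has_count has_pred1.
(* Depending on the colour by which [R] leaves [z], the edge [f] is an arc from [R] to [next c M] or
   from [N] to [R]. In either case [shortest_next] gives [z = y]. *)
case/mapP=> R Rc zR; have [Rs|Rs] := eqVneq R.2 s.
  have aR : carc R (next c M).
    by rewrite nM /alt_arc /= Rs eqxx /= -zR colour_sym.
  have nR : next c R = next c M.
    by apply: (shortest_next sc); rewrite // mem_next.
  have RM : R = M by rewrite -(prev_next uc R) nR prev_next.
  by rewrite zR RM My eqxx in zy.
have Rs' : R.2 = ~~ s by move: Rs; case: (R.2); case: (s).
have aN : carc N R by rewrite /alt_arc Rs' Ns eqxx /= Nx -zR.
have := shortest_next sc Nc Rc aN.
by rewrite nN => nR; rewrite zR -nR eqxx in zy.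
Qed.

Lemma colour_part_eq s : colour_part s = ab s.
Proof.
apply: lem_mdeg_eq; first exact: colour_part_le.
exact: (eq_vdeg_mdeg (vdeg_colour_part_ab s)).
Qed.

Lemma closed_walk_cycle : closed_walk ends (map fst c) (map node_edge c).
Proof.
rewrite /closed_walk -map_rot -map_next; last exact: (shortest_uniq sc).
rewrite -map_comp zip_map.
have all2_map2 (T U V : Type) (r : U -> V -> bool) (f : T -> U) (h : T -> V) d :
  all2 r (map f d) (map h d) = all (fun N => r (f N) (h N)) d by elim: d => //= N d ->.
by rewrite all2_map2; apply/allP => N /node_edgeP /andP[].
Qed.

(** Colours alternate along the path, so the positions of one parity are the nodes of one colour;
    the offset [j] is there for the induction. *)
Lemma alternating_prod (K : fieldType) P (s : seq ('I_n * bool)) j t : path carc P s ->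
  (\prod_(p <- zip (iota j (size (map node_edge (P :: s)))) (map node_edge (P :: s)) | odd p.1 == t)
    'X_(p.2) = \prod_(N <- P :: s | N.2 == P.2 (+) odd j (+) t) 'X_(node_edge N)
    :> {mpoly K[m]})%R.
Proof.
elim: s P j => [|Q s ih] P j /=.
  by rewrite !big_cons !big_nil /=; case: P.2; case: odd; case: (t).
case/andP=> /andP[/eqP QP _] pQ; rewrite big_cons (ih Q j.+1) // [RHS]big_cons /=.
have -> : Q.2 (+) ~~ odd j = P.2 (+) odd j by rewrite QP; case: P.2; case: odd.
by case: P.2; case: odd; case: (t).
Qed.

Lemma walk_binomial_cycle (K : fieldType) :
  ('X_[a] - 'X_[b] = walk_binomial K (map node_edge c))%R \/
  ('X_[a] - 'X_[b] = - walk_binomial K (map node_edge c))%R.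
Proof.
case: (sc) => + + _; have wE t : (\prod_(N <- c | N.2 == t) 'X_(node_edge N) = 'X_[ab t] :> {mpoly K[m]})%R.
  by rewrite -colour_part_eq -mprodXE.
rewrite /walk_binomial; case: (c) wE => // P s wE  _ /=.
rewrite rcons_path => /andP[ps _].
have := alternating_prod K 0 true ps; have := alternating_prod K 0 false ps.
rewrite !wE !addbF /= => e1 e2.
rewrite (eq_bigl (fun p => ~~ odd p.1)) in e1; last by move=> p; rewrite eqbF_neg.
rewrite (eq_bigl (fun p => odd p.1)) in e2; last by move=> p; rewrite eqb_id.
rewrite e1 e2.
by case: P.2; [left|right]; rewrite ?opprB.
Qed.

End Cycle.

Lemma gluing_circuit (K : fieldType) : a != 0%MM ->
  exists vs es, circuit_walk ends vs es /\
   ('X_[a] - 'X_[b] = walk_binomial K es \/ 'X_[a] - 'X_[b] = - walk_binomial K es)%R.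
Proof.
move=> a0.
have [e ae] := mnm_neq0 a0.
have [c0 sc0] : exists c, shortest c.
  apply: exists_shortest; apply: (@exists_cycle _ _ (fun N => vdeg a N.1 != 0) ((ends e).1, true)).
    apply/vdeg_gt0P; exists e => //.
    by rewrite /incidence eqxx.
  move=> [x s] /=; rewrite -(vdeg_ab s) => /vdeg_gt0P[f abf /incidence_neq0[y jxy]].
  exists (y, ~~ s); last by rewrite /alt_arc /= eqxx; apply/existsP; exists f; rewrite abf.
  rewrite /= -(vdeg_ab s); apply/vdeg_gt0P; exists f => //.
  by rewrite (incidence_joins _ jxy) eqxx addn1.
have [c [sc once shape]] := shortest_circuit colour_sym colour_irr colour_disj sc0.
exists (map fst c), (map (fun N => colour_edge N.2 N.1 (next c N).1) c); split.
  by split=> //; exact: closed_walk_cycle.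
exact: walk_binomial_cycle.
Qed.

End Gluing.
End VertexDegree.

Local Open Scope ring_scope.

(** * Lattices of split families *)

Section Recursion.
Variables (n m : nat) (ends : 'I_m -> 'I_n * 'I_n).
Local Notation pair_t := ('X_{1..m} * 'X_{1..m})%type.
Local Notation vdeg := (vdeg ends).
Implicit Types (r : pair_t) (S : seq pair_t) (C D : {set 'I_m}) (c : 'I_m -> int).

Definition exponent r (e : 'I_m) : int := Posz (r.1 e) - Posz (r.2 e).

Definition support_row r := (msupport r.1, msupport r.2).

Definition zdeg c (x : 'I_n) : int := \sum_e c e * Posz (incidence ends e x).

(** For the full edge set this is generation of the lattice [ker A]; the restriction to [C] is the
    form that passes to the two sides of a splitting. *)
Definition lattice_generates C S := forall c,
  (forall e, e \notin C -> c e = 0) -> (forall x, zdeg c x = 0) ->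
  exists k : pair_t -> int, forall e, c e = \sum_(r <- S) k r * exponent r e.

Lemma zdeg_nat (u : 'X_{1..m}) x : zdeg (fun e => Posz (u e)) x = Posz (vdeg u x).
Proof.
rewrite /zdeg /vdeg (big_morph Posz PoszD (erefl (Posz 0))).
by apply: eq_bigr => e _; rewrite PoszM.
Qed.

Lemma zdegD c c' x : zdeg (fun e => c e + c' e) x = zdeg c x + zdeg c' x.
Proof. by rewrite /zdeg -big_split; apply: eq_bigr => e _; rewrite mulrDl. Qed.

Lemma zdegZ t c x : zdeg (fun e => t * c e) x = t * zdeg c x.
Proof. by rewrite /zdeg big_distrr /=; apply: eq_bigr => e _; rewrite mulrA. Qed.

Lemma eq_zdeg c c' x : c =1 c' -> zdeg c x = zdeg c' x.
Proof. by move=> h; apply: eq_bigr => e _; rewrite h. Qed.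

Lemma zdeg_sum S (F : pair_t -> 'I_m -> int) x :
  zdeg (fun e => \sum_(r <- S) F r e) x = \sum_(r <- S) zdeg (F r) x.
Proof.
rewrite /zdeg exchange_big /=; apply: eq_bigr => e _.
by rewrite big_distrl.
Qed.

Lemma zdeg_exponent r x : zdeg (exponent r) x = Posz (vdeg r.1 x) - Posz (vdeg r.2 x).
Proof.
rewrite -!zdeg_nat -mulN1r -zdegZ -zdegD; apply: eq_zdeg => e.
by rewrite /exponent mulN1r.
Qed.

(** * One side of a split family *)

Section Side.
Variables (C D : {set 'I_m}) (S : seq pair_t) (r0 : pair_t) (f h : 'X_{1..m}).
Hypothesis DC : D \subset C.
Hypothesis S_deg : forall r, r \in S -> vdeg r.1 =1 vdeg r.2.
Hypothesis S_in : rows_in C (map support_row S).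
Hypothesis r0S : r0 \in S.
Hypothesis uS : uniq S.
Hypothesis fD : msupport f \subset D.
Hypothesis hD : msupport h \subset C :\: D.
Hypothesis h0 : h != 0%MM.
Hypothesis r0E : r0 = (f, h) \/ r0 = (h, f).
Hypothesis other : forall r, r \in S -> r != r0 ->
  inside D (support_row r) || inside (C :\: D) (support_row r).
Hypothesis gen : lattice_generates C S.

Definition side_rows D' := [seq r <- S | (r != r0) && inside D' (support_row r)].

Lemma out_support (u : 'X_{1..m}) D' e : msupport u \subset D' -> e \notin D' -> u e = 0%N.
Proof.
by move=> /subsetP s; apply: contraNeq => ue; apply: s; rewrite inE.
Qed.

Lemma exponent_out D' r e : inside D' (support_row r) -> e \notin D' -> exponent r e = 0.
Proof.
by move=> /andP[s1 s2] eD; rewrite /exponent (out_support s1) // (out_support s2).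
Qed.

Lemma side_sum_out D' k e : e \notin D' -> \sum_(r <- side_rows D') k r * exponent r e = 0.
Proof.
move=> eD; rewrite big_seq big1 // => r; rewrite mem_filter => /andP[/andP[_ i] _].
by rewrite (exponent_out i) // mulr0.
Qed.

Lemma zdeg_side_sum D' (k : pair_t -> int) x :
  zdeg (fun e => \sum_(r <- side_rows D') k r * exponent r e) x = 0.
Proof.
rewrite zdeg_sum big_seq big1 // => r; rewrite mem_filter => /andP[_ rS].
by rewrite zdegZ zdeg_exponent (S_deg rS) subrr mulr0.
Qed.

Lemma not_both r : r \in S -> inside D (support_row r) -> ~~ inside (C :\: D) (support_row r).
Proof.
move=> rS /andP[s1 _]; apply/negP => /andP[s2 _].
have [/set0Pn[e er] _ _ _] := rows_inP S_in (map_f _ rS).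
by have := subsetP s1 _ er; have := subsetP s2 _ er; rewrite inE => /andP[/negPf->].
Qed.

Lemma split_sum (k : pair_t -> int) : exists k0, forall e,
  \sum_(r <- S) k r * exponent r e = k0 * (Posz (f e) - Posz (h e)) +
   \sum_(r <- side_rows D) k r * exponent r e +
   \sum_(r <- side_rows (C :\: D)) k r * exponent r e.
Proof.
have [k0 k0E] : exists k0, forall e, k r0 * exponent r0 e = k0 * (Posz (f e) - Posz (h e)).
  case: r0E => ->; [exists (k (f, h)) | exists (- k (h, f))] => e; rewrite /exponent //=.
  by ring.
exists k0 => e; rewrite (bigD1_seq r0) //= k0E -addrA; congr (_ + _).
rewrite !big_filter (bigID (fun r => inside D (support_row r))) /=; congr (_ + _).
rewrite big_seq_cond [RHS]big_seq_cond; apply: eq_bigl => r.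
case rS : (r \in S) => //=; case rr0 : (r != r0) => //=.
have := other rS rr0; have := not_both rS.
by case: inside => //= /(_ isT) /negPf ->.
Qed.

(** Expressing [u - v] through the lattice and restricting to [D] leaves [k0] times [f] plus rows
    inside [D], whose vertex degree is zero. *)
Lemma side_rank1 u v : msupport u \subset D -> msupport v \subset C :\: D ->
  vdeg u =1 vdeg v ->
  exists t : int, forall x, Posz (vdeg u x) = t * Posz (vdeg f x).
Proof.
move=> su sv uv.
have sub D' e : D' \subset C -> e \notin C -> e \notin D'.
  by move=> /subsetP s; apply: contra => /s.
have [||k kE] := gen (c := fun e => Posz (u e) - Posz (v e)).
- move=> e eC; rewrite (out_support su (sub _ _ DC eC)).
  by rewrite (out_support sv (sub _ _ (subsetDl _ _) eC)).
- by move=> x; rewrite (zdeg_exponent (u, v)) /= uv subrr.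
have [k0 k0E] := split_sum k; exists k0 => x.
rewrite -!zdeg_nat -zdegZ -[RHS]addr0 -(zdeg_side_sum D k x) -zdegD.
apply: eq_zdeg => e; have := kE e; rewrite k0E.
have [eD|eD] := boolP (e \in D).
  have eD' : e \notin C :\: D by rewrite inE eD.
  rewrite (out_support sv eD') (out_support hD eD') (side_sum_out _ eD').
  by rewrite !subr0 => ->; ring.
by move=> _; rewrite (out_support su eD) (out_support fD eD) (side_sum_out _ eD) mulr0.
Qed.

(** Restricted to the complement of [D], the relation makes [k0] times [h] a combination of rows of
    degree zero. As [h] has nonzero degree, [k0 = 0] and the splitting row drops out. *)
Lemma side_generates : lattice_generates D (side_rows D).
Proof.
move=> c cD c0; have [//|k kE] := gen (c := c) _ c0.
  move=> e eC; apply: cD; by apply: contra eC; apply: (subsetP DC).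
have [k0 k0E] := split_sum k.
have cE e : c e = k0 * Posz (f e) + \sum_(r <- side_rows D) k r * exponent r e.
  have [eD|eD] := boolP (e \in D).
    have := kE e; rewrite k0E; have eD' : e \notin C :\: D by rewrite inE eD.
    by rewrite (out_support hD eD') (side_sum_out _ eD') subr0 addr0.
  by rewrite cD // (out_support fD eD) (side_sum_out _ eD) mulr0.
have hE e : k0 * Posz (h e) = \sum_(r <- side_rows (C :\: D)) k r * exponent r e.
  have := kE e; rewrite k0E cE => /eqP; rewrite -subr_eq0 => /eqP z.
  by apply/eqP; rewrite -subr_eq0 -{}[X in _ == X]z; apply/eqP; ring.
have k00 : k0 = 0.
  have [x hx] : exists x, vdeg h x != 0%N.
    have [e he] := mnm_neq0 h0.
    exists (ends e).1; apply/vdeg_gt0P; exists e => //.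
    by rewrite /incidence eqxx.
  have : k0 * Posz (vdeg h x) = 0.
    by rewrite -zdeg_nat -zdegZ (eq_zdeg _ hE) zdeg_side_sum.
  by move=> /eqP; rewrite mulf_eq0 eqz_nat (negPf hx) orbF => /eqP.
by exists k => e; rewrite cE k00 mul0r add0r.
Qed.

Lemma side_rows_in : rows_in D (map support_row (side_rows D)).
Proof.
apply/allP => rw /mapP[r]; rewrite mem_filter => /andP[/andP[_ /andP[i1 i2]] rS] ->.
have [n1 n2 _ _] := rows_inP S_in (map_f support_row rS).
by apply/and4P.
Qed.

Lemma side_dominating : dominating C (map support_row S) ->
  dominating D (map support_row (side_rows D)).
Proof.
apply: dominating_sub => // T _; rewrite !count_map count_filter.
by apply: sub_count => r /= /andP[].
Qed.

End Side.

Lemma glued C S : (forall r, r \in S -> vdeg r.1 =1 vdeg r.2) ->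
  rows_in C (map support_row S) -> dominating C (map support_row S) ->
  lattice_generates C S -> forall r, r \in S -> exists C1 C2,
  [/\ [disjoint C1 & C2], msupport r.1 \subset C1, msupport r.2 \subset C2 &
      forall u v, msupport u \subset C1 -> msupport v \subset C2 ->
      vdeg u =1 vdeg v ->
      exists t : int, forall x, Posz (vdeg u x) = t * Posz (vdeg r.1 x)].
Proof.
move: {2}(size S).+1 (ltnSn (size S)) => N; elim: N C S => // N IH C S ltS degS rin dom gen r rS.
have Sn : map support_row S != [::] by case: (S) rS.
have uR := dominating_uniq dom rin; have uS := map_uniq uR.
have [_ [D [/mapP[r0 r0S ->] DC sep oth]]] := dominating_splits Sn rin dom.
have [n1 n2 _ _] := rows_inP rin (map_f support_row r0S).
have ne0 (u : 'X_{1..m}) : msupport u != set0 -> u != 0%MM.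
  by move=> /set0Pn[e]; rewrite inE; apply: contraNneq => ->; rewrite mnm0E.
have {sep} : exists E1 : {set 'I_m}, [/\ E1 \subset C, msupport r0.1 \subset E1,
    msupport r0.2 \subset C :\: E1 & forall r, r \in S -> r != r0 ->
    inside E1 (support_row r) || inside (C :\: E1) (support_row r)].
  have oth' r' : r' \in S -> r' != r0 ->
      inside D (support_row r') || inside (C :\: D) (support_row r').
    move=> r'S r'0; apply: oth; first exact: map_f.
    by apply: contra r'0 => /eqP/(uniq_map_inj uR r'S r0S)->.
  case/orP: sep => /andP[/= s1 s2]; first by exists D.
  have CD : C :\: (C :\: D) = D by rewrite setDDr setDv set0U; apply/setIidPr.
  exists (C :\: D); rewrite CD; split=> //; first exact: subsetDl.
  by move=> r' r'S r'0; rewrite orbC oth'.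
case=> E1 [E1C s1 s2 {}oth].
have CE : C :\: (C :\: E1) = E1 by rewrite setDDr setDv set0U; apply/setIidPr.
have lt (D' : {set 'I_m}) : (size (side_rows S r0 D') < size S)%N.
  rewrite size_filter -(count_predC (pred1 r0) S).
  have -> : count (pred1 r0) S = 1%N by rewrite (count_uniq_mem _ uS) r0S.
  by rewrite add1n ltnS; apply: sub_count => r' /= /andP[].
have [->|rr0] := eqVneq r r0.
  exists E1, (C :\: E1); split=> //.
    by rewrite disjoints_subset setCD subsetUr.
  move=> u v su sv uv.
  apply: (@side_rank1 C E1 S r0 r0.1 r0.2) su sv uv => //.
  by left; case: (r0).
have ih (D' : {set 'I_m}) f h : D' \subset C -> msupport f \subset D' -> msupport h \subset C :\: D' ->
    h != 0%MM -> (r0 = (f, h) \/ r0 = (h, f)) ->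
    (forall r, r \in S -> r != r0 -> inside D' (support_row r) || inside (C :\: D') (support_row r)) ->
    inside D' (support_row r) -> exists C1 C2,
  [/\ [disjoint C1 & C2], msupport r.1 \subset C1, msupport r.2 \subset C2 &
      forall u v, msupport u \subset C1 -> msupport v \subset C2 ->
      vdeg u =1 vdeg v ->
      exists t : int, forall x, Posz (vdeg u x) = t * Posz (vdeg r.1 x)].
  move=> D'C fD hD h0 r0E oth' ir; apply: (IH D' (side_rows S r0 D')).
  - by apply: leq_trans (lt D') _.
  - by move=> r'; rewrite mem_filter => /andP[_ /degS].
  - exact: (@side_rows_in C).
  - exact: (@side_dominating C).
  - exact: (@side_generates C D' S r0 f h).
  - by rewrite mem_filter rr0 ir.
case/orP: (oth _ rS rr0) => ir.
  by apply: (ih E1 r0.1 r0.2) => //; [exact: ne0 | left; case: (r0)].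
apply: (ih (C :\: E1) r0.2 r0.1) => //; rewrite ?CE ?subsetDl //.
- exact: ne0.
- by right; case: (r0).
- by move=> r' r'S r'0; rewrite orbC oth.
Qed.

End Recursion.

Arguments support_row {m} r.

(** * Chains of primes *)

Section PrimeChains.
Variables (K : fieldType) (m : nat).
Local Notation poly := {mpoly K[m]}.
Implicit Types (P Q : poly -> Prop) (f : poly).

Definition indep_mod P (J : finType) (z : J -> poly) :=
  forall c : J -> K, P (\sum_j c j *: z j) -> forall j, c j = 0.

Lemma ideal_sub P x y : is_ideal P -> P (x + y) -> P y -> P x.
Proof.
by case=> _ PD PM Pxy Py; rewrite -[x](addrK y); apply: PD => //; rewrite -mulN1r; apply: PM.
Qed.

(** Modulo [Q] only the terms without [f] survive, so their coefficients vanish; primality of [P]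
    then allows division by [f]. *)
Lemma indep_powers P Q f (J : finType) (z : J -> poly) d (c : nat -> J -> K) :
  prime_ideal P -> is_ideal Q -> psubset P Q -> Q f -> ~ P f -> indep_mod Q z ->
  P (\sum_(i < d) \sum_j c i j *: (f ^+ i * z j)) -> forall i j, (i < d)%N -> c i j = 0.
Proof.
move=> [[P0 PD PM] _ Pp] Qid PQ Qf Pf zi; elim: d c => // d ih c.
rewrite big_ord_recl /=.
have -> : \sum_(i < d) \sum_j c (bump 0 i) j *: (f ^+ bump 0 i * z j) =
    f * \sum_(i < d) \sum_j c i.+1 j *: (f ^+ i * z j).
  rewrite big_distrr /=; apply: eq_bigr => i _; rewrite big_distrr /=; apply: eq_bigr => j _.
  by rewrite /bump /= add1n exprS -mulrA scalerAr.
set S0 := \sum_j _; set S1 := \sum_(i < d) _ => PS.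
have c0 j : c 0%N j = 0.
  apply: (zi (c 0%N)).
  have -> : \sum_j c 0%N j *: z j = S0 by apply: eq_bigr => k _; rewrite expr0 mul1r.
  case: (Qid) => _ _ QM; apply: (ideal_sub Qid (PQ _ PS)).
  by rewrite mulrC; exact: QM.
have S00 : S0 = 0 by rewrite /S0 big1 // => j _; rewrite c0 scale0r.
move: PS; rewrite S00 add0r => /Pp[//|PS1] [|i] j; first by rewrite c0.
by rewrite ltnS; apply: (ih (fun i => c i.+1)).
Qed.

Lemma msize_powers f (z : poly) i d B : (i < d)%N -> (msize z <= B)%N ->
  (msize (f ^+ i * z) <= B + d * msize f)%N.
Proof.
move=> lt lz; apply: leq_trans (_ : msize z + i * msize f <= _)%N; last first.
  by apply: leq_add => //; rewrite leq_mul2r ltnW ?orbT.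
elim: i {lt} => [|i ih]; first by rewrite expr0 mul1r leq_addr.
rewrite exprS -mulrA; set q := _ * z in ih *.
have [->|f0] := eqVneq f 0; first by rewrite mul0r msize0.
have [->|q0] := eqVneq q 0; first by rewrite mulr0 msize0.
by rewrite msizeM // mulSn addnCA; apply: leq_trans (leq_pred _) _; rewrite leq_add2l.
Qed.

(** Going down one step of the chain multiplies the number of independent elements by [d], using the
    powers of an element that leaves the prime, while sizes grow only linearly in [d]; [D] depends
    on the chain alone. *)
Lemma chain_indep h (c : nat -> poly -> Prop) :
  (forall i, (i <= h)%N -> prime_ideal (c i)) ->
  (forall i, (i < h)%N -> pstrict_subset (c i) (c i.+1)) ->
  exists D, forall d (J : finType) (z : J -> poly) B,
    indep_mod (c h) z -> (forall j, (msize (z j) <= B)%N) ->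
    exists (J' : finType) (z' : J' -> poly),
      [/\ #|J'| = (d ^ h * #|J|)%N, indep_mod (c 0%N) z' &
          forall j, (msize (z' j) <= B + d * D)%N].
Proof.
elim: h c => [|h ih] c pr st.
  by exists 0%N => d J z B zi zB; exists J, z; rewrite mul1n muln0 addn0.
have [||D hD] := ih c.
- by move=> i ih'; apply: pr; rewrite leqW.
- by move=> i ih'; apply: st; rewrite leqW.
have [sub [f [Qf Pf]]] := st h (ltnSn h).
exists (msize f + D)%N => d J z B zi zB.
pose z1 (ij : 'I_d * J) := f ^+ ij.1 * z ij.2.
have [||J' [z' [cJ zi' zB']]] := hD d _ z1 (B + d * msize f)%N.
- move=> k Pk [i j]; case: (pr h.+1) => // Qid _ _.
  pose k' (i : nat) j := if insub i is Some i' then k (i', j) else 0.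
  have := @indep_powers (c h) (c h.+1) f J z d k' (pr h (leqnSn h)) Qid sub Qf Pf zi.
  move=> /(_ _ i j (ltn_ord i)); rewrite /k' valK; apply.
  rewrite pair_bigA /=; move: Pk; congr (c h _); apply: eq_bigr => -[i' j'] _ /=.
  by rewrite valK.
- by move=> [i j]; apply: msize_powers.
exists J', z'; split=> //.
  by rewrite cJ card_prod card_ord mulnA expnSr.
by move=> j; apply: leq_trans (zB' j) _; rewrite mulnDr addnA.
Qed.

(** Polynomials of size at most [N] involve only the [N ^ m] monomials with exponents below [N], and
    independence modulo [P] implies linear independence. *)
Lemma indep_card P (J : finType) (z : J -> poly) N : P 0 -> indep_mod P z ->
  (forall j, (msize (z j) <= N)%N) -> (#|J| <= N ^ m)%N.
Proof.
move=> P0 zi zN; pose F := {ffun 'I_m -> 'I_N}.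
pose mon (g : F) : 'X_{1..m} := [multinom (g i : nat) | i < m].
pose A := \matrix_(j < #|J|, g < #|F|) (z (enum_val j))@_(mon (enum_val g)).
suff : row_free A.
  move=> /eqP rA; have := rank_leq_col A; rewrite rA card_ffun !card_ord.
  by [].
apply: inj_row_free => v vA; apply/rowP => j; rewrite mxE.
pose c x := v ord0 (enum_rank x).
have := zi c _ (enum_val j); rewrite /c enum_valK; apply.
suff -> : \sum_x c x *: z x = 0 by [].
apply/mpolyP => w; rewrite mcoeff0 raddf_sum /=.
have [wN|wN] := boolP [forall i, (w i < N)%N]; last first.
  rewrite big1 // => x _; rewrite mcoeffZ memN_msupp_eq0 ?mulr0 //.
  apply: contra wN => /msize_mdeg_lt lt; apply/forallP => i.
  apply: leq_ltn_trans (leq_trans lt (zN x)); rewrite mdegE (bigD1 i) //=.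
  exact: leq_addr.
pose g : F := [ffun i => Ordinal (forallP wN i)].
have wE : w = mon g by apply/mnmP => i; rewrite mnmE ffunE.
have /rowP/(_ (enum_rank g)) := vA; rewrite !mxE => h; rewrite -[RHS]h.
rewrite (reindex (enum_val : 'I_#|J| -> J)) /=; last first.
  by exists enum_rank => x _; rewrite ?enum_valK ?enum_rankK.
by apply: eq_bigr => k _; rewrite mcoeffZ /c enum_valK mxE enum_rankK wE.
Qed.

Lemma indep_growth r C : (forall d, (0 < d)%N -> exists (J : finType) (z : J -> poly) P,
    [/\ #|J| = (d ^ r)%N, P 0, indep_mod P z & forall j, (msize (z j) <= d * C)%N]) ->
  (r <= m)%N.
Proof.
move=> h; rewrite leqNgt; apply/negP => lt.
(* This [d] exceeds the constant [C ^ m] of the bound [d ^ r <= d ^ m * C ^ m]. *)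
have [//|J [z [P [cJ P0 zi zC]]]] := h (C ^ m).+1.
have := indep_card P0 zi zC; rewrite cJ expnMn => le.
have : ((C ^ m).+1 ^ m.+1 <= (C ^ m).+1 ^ r)%N by rewrite leq_pexp2l.
move=> /leq_trans/(_ le); rewrite expnS mulnC leq_mul2l expn_eq0 /=.
by rewrite ltnn.
Qed.

End PrimeChains.

(** * Toric ideals *)

Section Toric.
Variables (n m : nat) (ends : 'I_m -> 'I_n * 'I_n) (K : fieldType).
Local Notation vdeg := (vdeg ends).
Local Notation toric_map := (toric_map ends K).
Local Notation I := (toric_ideal ends K).
Implicit Types u v : 'X_{1..m}.

Definition vmon u : 'X_{1..n} := [multinom vdeg u x | x < n].

Lemma vmonP u v : vmon u = vmon v <-> vdeg u =1 vdeg v.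
Proof.
split=> [/mnmP h x|h]; first by have := h x; rewrite !mnmE.
by apply/mnmP => x; rewrite !mnmE.
Qed.

Lemma toric_mapX u : toric_map 'X_[u] = 'X_[vmon u].
Proof.
rewrite /Defs.toric_map mmapX /mmap1.
under eq_bigr => e _ do rewrite -mpolyXD mpolyXn.
rewrite mprodXE; congr 'X_[_]; apply/mnmP => x; rewrite mnmE mnm_sumE.
by apply: eq_bigr => e _; rewrite mulmnE mnmDE !mnm1E mulnC.
Qed.

Lemma toric_mapD p q : toric_map (p + q) = toric_map p + toric_map q.
Proof. exact: mmapD. Qed.

Lemma toric_mapM p q : toric_map (p * q) = toric_map p * toric_map q.
Proof. exact: (rmorphM (mmap _ _)). Qed.

Lemma toric_map1 : toric_map 1 = 1.
Proof. exact: (rmorph1 (mmap _ _)). Qed.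

Lemma toric_mapZ c p : toric_map (c *: p) = c *: toric_map p.
Proof. by rewrite /Defs.toric_map mmapZ mul_mpolyC. Qed.

Lemma toric_map_sum (T : Type) (r : seq T) (F : T -> {mpoly K[m]}) :
  toric_map (\sum_(i <- r) F i) = \sum_(i <- r) toric_map (F i).
Proof. exact: (raddf_sum (mmap _ _)). Qed.

Lemma toric_prime : prime_ideal I.
Proof.
split; first split.
- exact: mmap0.
- by move=> x y; rewrite /toric_ideal toric_mapD => -> ->; rewrite addr0.
- by move=> x y; rewrite /toric_ideal toric_mapM => ->; rewrite mulr0.
- by rewrite /toric_ideal toric_map1; apply/eqP; rewrite oner_eq0.
- move=> x y /eqP; rewrite toric_mapM mulf_eq0 => /orP[]/eqP; by [left|right].
Qed.

Lemma toric_binomial u v : I ('X_[u] - 'X_[v]) <-> vdeg u =1 vdeg v.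
Proof.
rewrite /toric_ideal /Defs.toric_map mmapB -!/(Defs.toric_map _ _ _) !toric_mapX -vmonP.
split=> [/eqP|->]; last by rewrite subrr.
rewrite subr_eq0 => /eqP/(congr1 (mcoeff (vmon u))).
rewrite !mcoeffX eqxx; case: eqP => // _ /eqP; by rewrite oner_eq0.
Qed.

Definition incidence_mx : 'M[rat]_(m, n) := \matrix_(e, x) (incidence ends e x)%:R.

(** Monomials in edges whose incidence rows form a basis of the row space have distinct images, so
    they are independent modulo the toric ideal and start the count at the top of the chain. *)
Lemma toric_chain_bound h : prime_chain_to I h -> (h + \rank incidence_mx <= m)%N.
Proof.
case=> c [pr st cI]; set rho := \rank _.
have [D hD] := chain_indep pr st; pose f := maxrankfun incidence_mx.
apply: (@indep_growth K m _ (rho + 1 + D)%N) => d d0.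
pose mon (g : {ffun 'I_rho -> 'I_d}) := (\sum_i U_(f i) *+ (g i))%MM.
have [||J' [z' [cJ zi zB]]] := hD d _ (fun g => 'X_[mon g]) (d * (rho + 1))%N.
- move=> k; rewrite cI /toric_ideal toric_map_sum => kE g.
  have injmon : injective (fun g => vmon (mon g)).
    move=> g1 g2 /vmonP eqd; pose v : 'rV[rat]_rho := \row_i ((g1 i)%:R - (g2 i)%:R).
    have vdE (g' : {ffun 'I_rho -> 'I_d}) x :
        (vdeg (mon g') x)%:R = \sum_i (g' i)%:R * incidence_mx (f i) x :> rat.
      rewrite vdeg_sum natr_sum; apply: eq_bigr => i _; rewrite mxE -natrM.
      congr (_%:R); elim: (nat_of_ord (g' i)) => [|k' ih]; first by rewrite mulm0n vdeg0.
      by rewrite mulmS vdegD vdegU ih mulSn.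
    have v0 : v *m rowsub f incidence_mx = 0.
      apply/rowP => x; rewrite !mxE.
      transitivity ((vdeg (mon g1) x)%:R - (vdeg (mon g2) x)%:R : rat); last by rewrite eqd subrr.
      rewrite !vdE -sumrB; apply: eq_bigr => i _; by rewrite !mxE mulrBl.
    have {}v0 : v = 0.
      by apply: (row_free_inj (maxrowsub_free incidence_mx)); rewrite mul0mx.
    apply/ffunP => i; apply: val_inj; move/rowP/(_ i): v0; rewrite !mxE => /eqP.
    by rewrite subr_eq0 eqr_nat => /eqP.
  have := congr1 (mcoeff (vmon (mon g))) kE; rewrite mcoeff0 raddf_sum /= (bigD1 g) //=.
  rewrite toric_mapZ toric_mapX mcoeffZ mcoeffX eqxx mulr1 big1 ?addr0 // => g' g'g.
  by rewrite toric_mapZ toric_mapX mcoeffZ mcoeffX (inj_eq injmon) (negPf g'g) mulr0.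
- move=> g; rewrite msizeX mdeg_sum mulnDr muln1 -addn1 leq_add //.
  apply: leq_trans (_ : \sum_(i < rho) d <= _)%N; last by rewrite sum_nat_const card_ord mulnC.
  by apply: leq_sum => i _; rewrite mdegMn mdeg1 mul1n ltnW.
exists J', z', (c 0%N); split=> //.
- by rewrite cJ card_ffun !card_ord -expnD.
- by case: (pr 0%N) => // -[].
- by move=> j; rewrite mulnDr.
Qed.

Lemma toric_height_bound h : ideal_height I h -> (h + \rank incidence_mx <= m)%N.
Proof.
case=> _ hmin.
(* Here [k] is [m] minus the length of a chain, so its minimum selects a longest chain. *)
have [|k Pk kmin] := @nat_minimum (fun k => exists2 j, prime_chain_to I j & j + k = m)%N.
  exists m, 0%N => //; exists (fun _ => I); split=> // i _; exact: toric_prime.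
case: Pk => j chj jk.
have : (h <= j)%N.
  apply: (hmin I) => //; [exact: toric_prime | split=> // l chl].
  have := toric_chain_bound chl; have := kmin (m - l)%N => /(_ _) h1 h2.
  have : (k <= m - l)%N by apply: h1; exists l; rewrite // subnKC //; move: h2; clear; lia.
  by move: jk h2; clear; lia.
by have := toric_chain_bound chj; clear; lia.
Qed.

End Toric.

(** * Ideals generated by finite sequences *)

Section GeneratedIdeals.
Variable R : comRingType.
Implicit Types (s : seq R) (p q : R).

Lemma in_ideal_genP s p : in_ideal_gen s p <->
  exists c : nat -> R, p = \sum_(i < size s) c i * s`_i.
Proof.
split=> [[c ->]|[c ->]].
  exists (fun i => if insub i is Some j then c j else 0); apply: eq_bigr => i _.
  by rewrite valK (tnth_nth 0).
by exists (fun i => c i); apply: eq_bigr => i _; rewrite (tnth_nth 0).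
Qed.

Lemma in_ideal_gen_ideal s : is_ideal (in_ideal_gen s).
Proof.
split.
- by exists (fun _ => 0); rewrite big1 // => i _; rewrite mul0r.
- move=> _ _ [c ->] [c' ->]; exists (fun i => c i + c' i).
  by rewrite -big_split; apply: eq_bigr => i _; rewrite mulrDl.
- move=> r _ [c ->]; exists (fun i => r * c i).
  by rewrite big_distrr /=; apply: eq_bigr => i _; rewrite mulrA.
Qed.

Lemma ideal_sum (J : R -> Prop) (T : Type) (r : seq T) (Q : pred T) (F : T -> R) :
  is_ideal J -> (forall i, Q i -> J (F i)) -> J (\sum_(i <- r | Q i) F i).
Proof. by case=> J0 JD _ h; elim/big_ind: _. Qed.

Lemma in_ideal_gen_mem s p : p \in s -> in_ideal_gen s p.
Proof.
move=> ps; apply/in_ideal_genP; exists (fun i => (i == index p s)%:R).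
have lt : (index p s < size s)%N by rewrite index_mem.
rewrite (bigD1 (Ordinal lt)) //= eqxx mul1r nth_index // big1 ?addr0 // => i.
by rewrite -val_eqE /= => /negPf->; rewrite mul0r.
Qed.

Lemma in_ideal_gen_min s (J : R -> Prop) p : is_ideal J -> (forall x, x \in s -> J x) ->
  in_ideal_gen s p -> J p.
Proof.
move=> Jid Js [c ->]; apply: ideal_sum => // i _; case: Jid => _ _; apply.
by apply: Js; rewrite mem_tnth.
Qed.

Lemma mem_remove s k l : (l < size s)%N -> l != k -> s`_l \in take k s ++ drop k.+1 s.
Proof.
move=> ls lk; rewrite mem_cat; case: (ltngtP l k) lk => // lk _.
  by apply/orP; left; rewrite -(nth_take 0 lk) mem_nth // size_take_min leq_min lk.
have -> : s`_l = (drop k.+1 s)`_(l - k.+1) by rewrite nth_drop subnKC.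
by apply/orP; right; rewrite mem_nth // size_drop ltn_sub2r // (leq_ltn_trans lk).
Qed.

Lemma generates_remove (J : R -> Prop) s k : generates J s -> (k < size s)%N ->
  in_ideal_gen (take k s ++ drop k.+1 s) s`_k -> generates J (take k s ++ drop k.+1 s).
Proof.
move=> gen ks kin p; rewrite gen; split; apply: in_ideal_gen_min;
  try exact: in_ideal_gen_ideal.
  move=> x /(nthP 0)[l ls <-]; have [->//|lk] := eqVneq l k.
  by apply: in_ideal_gen_mem; exact: mem_remove.
by move=> x; rewrite mem_cat => /orP[/mem_take|/mem_drop]; exact: in_ideal_gen_mem.
Qed.

End GeneratedIdeals.

(** * Homogeneous components and minimal generators *)

Section Homogeneous.
Variables (K : fieldType) (m : nat).
Implicit Types (p b : {mpoly K[m]}).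

Lemma pihomogM d e p b : b \is e.-homog ->
  pihomog mdeg d (p * b) = if (e <= d)%N then pihomog mdeg (d - e) p * b else 0.
Proof.
move=> hb; rewrite [in LHS](pihomog_partitionE (leqnn (mmeasure mdeg p))) big_distrl /= raddf_sum /=.
set N := mmeasure _ _.
have hom (i : nat) : pihomog mdeg i p * b \is (i + e).-homog by apply: dhomogM (pihomogP _ _ _) hb.
case: leqP => [le|lt]; last first.
  by rewrite big1 // => i _; apply: (pihomog_ne0 _ (hom i)); move: lt; clear; lia.
have [ltN|geN] := ltnP (d - e) N.
  rewrite (bigD1 (Ordinal ltN)) //= pihomog_dE ?big1 ?addr0 //.
  - move=> i; rewrite -val_eqE /= => ne; apply: (pihomog_ne0 _ (hom i)).
    by move: ne le; clear; lia.
  - by have := hom (d - e)%N; rewrite subnK.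
rewrite big1 => [|i _].
  rewrite [pihomog _ _ p]big1_seq ?mul0r // => w /andP[/eqP dw wp].
  by have := mmeasure_mnm_lt mdeg wp; rewrite dw ltnNge geN.
by apply: (pihomog_ne0 _ (hom i)); have := ltn_ord i; move: geN le; clear; lia.
Qed.

Lemma pihomog0E p : pihomog mdeg 0 p = (p@_0)%:MP.
Proof.
rewrite /pihomog (eq_bigl (fun w : 'X_{1..m} => w == 0%MM)); last by move=> w; rewrite mdeg_eq0.
have [in0|out0] := boolP (0%MM \in msupp p).
  rewrite big_mkcond (bigD1_seq 0%MM) //= eqxx mpolyX0 alg_mpolyC big1 ?addr0 //.
  by move=> w /negPf->.
rewrite (memN_msupp_eq0 out0) mpolyC0 big_seq_cond big_pred0 // => w.
by case: eqP => [->|]; rewrite ?andbF // (negPf out0).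
Qed.

(* Graded Nakayama: a syzygy with a unit coefficient would, in the degree of the
   corresponding generator, express that generator through the others. *)
Lemma syzygy_coef0 (S : seq {mpoly K[m]}) (I : {mpoly K[m]} -> Prop) (c : nat -> {mpoly K[m]}) :
  (forall b, b \in S -> exists d, b \is d.-homog) -> generates I S ->
  (forall i, (i < size S)%N -> ~ generates I (take i S ++ drop i.+1 S)) ->
  \sum_(i < size S) c i * S`_i = 0 -> forall i, (i < size S)%N -> (c i)@_0 = 0.
Proof.
move=> hom gen irr rel k kS; apply/eqP/negPn/negP => ck; apply: (irr k kS).
apply: generates_remove => //; have Iid := in_ideal_gen_ideal (take k S ++ drop k.+1 S).
have [d hd] := hom _ (mem_nth 0 kS).
have deg l : exists e, (l < size S)%N -> S`_l \is e.-homog.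
  case: (ltnP l (size S)) => lS; last by exists 0%N.
  by have [e he] := hom _ (mem_nth 0 lS); exists e.
have := congr1 (pihomog mdeg d) rel; rewrite raddf0 raddf_sum /= (bigD1 (Ordinal kS)) //=.
rewrite (pihomogM _ _ hd) leqnn subnn pihomog0E => /eqP; rewrite addr_eq0 => /eqP E.
have -> : S`_k = ((c k)@_0)^-1%:MP * (((c k)@_0)%:MP * S`_k).
  by rewrite mulrA -mpolyCM mulVf // mpolyC1 mul1r.
case: (Iid) => _ _; apply; rewrite E -mulN1r; case: (Iid) => _ _; apply.
apply: ideal_sum => // l lk; have [e he] := deg l.
rewrite (pihomogM _ _ (he (ltn_ord l))); case: ifP => _; last by case: Iid.
case: Iid => _ _; apply; apply: in_ideal_gen_mem; exact: mem_remove.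
Qed.

(** Each family is expressed through the other. The product of the coefficient matrices differs from
    the identity by syzygies of [S], whose constant terms vanish, so the constant terms form
    matrices with product 1 over the field. *)
Lemma minimal_generators_size (S s : seq {mpoly K[m]}) (I : {mpoly K[m]} -> Prop) :
  (forall b, b \in S -> exists d, b \is d.-homog) -> generates I S ->
  (forall i, (i < size S)%N -> ~ generates I (take i S ++ drop i.+1 S)) ->
  generates I s -> (size S <= size s)%N.
Proof.
move=> hom genS irr gens.
have hc (i : 'I_(size S)) : exists c : nat -> {mpoly K[m]}, S`_i = \sum_(j < size s) c j * s`_j.
  by apply/in_ideal_genP; apply/gens/genS/in_ideal_gen_mem; rewrite mem_nth.
have hd (j : 'I_(size s)) : exists d : nat -> {mpoly K[m]}, s`_j = \sum_(i < size S) d i * S`_i.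
  by apply/in_ideal_genP; apply/genS/gens/in_ideal_gen_mem; rewrite mem_nth.
have [c cE] := fin_all_exists hc; have [d dE] := fin_all_exists hd.
pose A := \matrix_(i < size S, j < size s) (c i j)@_0.
pose B := \matrix_(j < size s, i < size S) (d j i)@_0.
suff AB : A *m B = 1%:M.
  by have := mxrankM_maxl A B; rewrite AB mxrank1 => /leq_trans; apply; exact: rank_leq_col.
apply/matrixP => i k; rewrite !mxE.
pose r (k : nat) := \sum_(j < size s) c i j * d j k - (k == i :> nat)%:R.
have := @syzygy_coef0 S I r hom genS irr _ k (ltn_ord k).
rewrite /r mcoeffB raddf_sum /= => h; apply/eqP; rewrite -subr_eq0; apply/eqP.
apply: etrans (h _).
  congr (_ - _); first by apply: eq_bigr => j _; rewrite !mxE (rmorphM (mcoeff 0)).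
  by rewrite -mpolyC_nat mcoeffC eqxx mulr1 eq_sym.
under eq_bigr => l _ do rewrite mulrBl big_distrl /=.
rewrite sumrB exchange_big /=.
have -> : \sum_(l < size S) (l == i :> nat)%:R * S`_l = S`_i.
  rewrite (bigD1 i) //= eqxx mul1r big1 ?addr0 // => l.
  by rewrite -val_eqE /= => /negPf ->; rewrite mul0r.
rewrite [in X in _ - X]cE; apply/eqP; rewrite subr_eq0; apply/eqP; apply: eq_bigr => j _.
by rewrite dE big_distrr /=; apply: eq_bigr => l _; rewrite mulrA.
Qed.

End Homogeneous.

(** * Growth of quotients *)

Section Spanning.
Variables (K : fieldType) (m : nat).
Local Notation poly := {mpoly K[m]}.
Implicit Types (Z : poly -> Prop) (p q x : poly).

(** The linear span in impredicative form, so that a membership proof is its own induction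
    principle. *)
Definition lspan Z p := forall F : poly -> Prop,
  F 0 -> (forall p q, F p -> F q -> F (p + q)) -> (forall k p, F p -> F (k *: p)) ->
  (forall x, Z x -> F x) -> F p.

Lemma lspan0 Z : lspan Z 0. Proof. by []. Qed.

Lemma lspanD Z p q : lspan Z p -> lspan Z q -> lspan Z (p + q).
Proof. by move=> hp hq F F0 FD FZ FX; apply: FD (hp F F0 FD FZ FX) (hq F F0 FD FZ FX). Qed.

Lemma lspanZ Z k p : lspan Z p -> lspan Z (k *: p).
Proof. by move=> hp F F0 FD FZ FX; apply: FZ (hp F F0 FD FZ FX). Qed.

Lemma lspan_mem Z x : Z x -> lspan Z x.
Proof. by move=> Zx F _ _ _; apply. Qed.

Lemma lspanM Z Z' p q : lspan Z p -> (forall x, Z x -> lspan Z' (x * q)) -> lspan Z' (p * q).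
Proof.
move=> hp h; apply: (hp (fun p => lspan Z' (p * q))) => //.
- by rewrite mul0r; exact: lspan0.
- by move=> *; rewrite mulrDl; exact: lspanD.
- by move=> *; rewrite -scalerAl; exact: lspanZ.
Qed.

Lemma span_card (U F : finType) (mon : U -> 'X_{1..m}) (z : F -> poly) : injective mon ->
  (forall g, exists c : F -> K, 'X_[mon g] = \sum_x c x *: z x) -> (#|U| <= #|F|)%N.
Proof.
move=> inj /fin_all_exists[c cE].
pose A := \matrix_(g < #|U|, x < #|F|) c (enum_val g) (enum_val x).
pose B := \matrix_(x < #|F|, g < #|U|) (z (enum_val x))@_(mon (enum_val g)).
suff AB : A *m B = 1%:M.
  by have := mxrankM_maxl A B; rewrite AB mxrank1 => /leq_trans; apply; exact: rank_leq_col.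
apply/matrixP => g h; rewrite !mxE.
transitivity (('X_[mon (enum_val g)] : poly)@_(mon (enum_val h))); last first.
  by rewrite mcoeffX (inj_eq inj) (inj_eq enum_val_inj).
rewrite cE raddf_sum /= (reindex (enum_val : 'I_#|F| -> F)) /=; last first.
  by exists enum_rank => x _; rewrite ?enum_valK ?enum_rankK.
by apply: eq_bigr => x _; rewrite !mxE mcoeffZ.
Qed.

Variables (G : seq (nat * poly)) (W : pred 'X_{1..m}).
Hypothesis G_homog : forall y, y \in G -> (0 < y.1)%N /\ y.2 \is y.1.-homog.
Hypothesis W_repr : forall u, in_ideal_gen (map snd G) 'X_[u] \/
  exists w, [/\ W w, mdeg w = mdeg u & in_ideal_gen (map snd G) ('X_[u] - 'X_[w])].

Local Notation N := (size G).
Let g (l : nat) : poly := (nth (1%N, 0) G l).2.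
Let dg (l : nat) : nat := (nth (1%N, 0) G l).1.

Definition power_product (w : 'X_{1..m}) (c : nat -> nat) : poly :=
  'X_[w] * \prod_(l < N) g l ^+ c l.

Definition spanners d x := exists w (c : nat -> nat),
  [/\ W w, (mdeg w + \sum_(l < N) c l * dg l = d)%N & x = power_product w c].

(** Modulo [G] a monomial becomes zero or a monomial in [W] of the same degree. The difference is a
    combination of elements of [G] whose coefficients can be taken homogeneous of smaller degree,
    and induction expands these. *)
Lemma homog_span d p : p \is d.-homog -> lspan (spanners d) p.
Proof.
elim/ltn_ind: d p => d IH p hp.
have gh l : (l < N)%N -> (0 < dg l)%N /\ g l \is (dg l).-homog.
  by move=> lN; apply: G_homog; apply: mem_nth.
suff mon u : mdeg u = d -> lspan (spanners d) 'X_[u].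
  rewrite [p]mpolyE big_seq; elim/big_ind: _ => [||u up]; [exact: lspan0|by move=> *; apply: lspanD|].
  by apply: lspanZ; apply: mon; apply: (dhomog_mf hp).
move=> ud.
have [r [rs rh rG]] : exists r, [/\ lspan (spanners d) r, r \is d.-homog &
    in_ideal_gen (map snd G) ('X_[u] - r)].
  case: (W_repr u) => [uG|[w [Ww wu wG]]].
    by exists 0; rewrite subr0; split=> //; exact: dhomog0.
  exists 'X_[w]; split=> //; last by rewrite dhomogX /= wu ud.
  apply: lspan_mem; exists w, (fun _ => 0%N); split=> //.
    by rewrite big1 ?addn0 ?wu.
  by rewrite /power_product big1 ?mulr1 // => l _; rewrite expr0.
rewrite -(subrK r 'X_[u]); apply: lspanD => //.
have hr : 'X_[u] - r \is d.-homog by rewrite rpredB // dhomogX /= ud.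
rewrite -(pihomog_dE hr); have [c ->] := proj1 (in_ideal_genP _ _) rG.
rewrite size_map raddf_sum /=; elim/big_ind: _ => [||l _]; [exact: lspan0|by move=> *; apply: lspanD|].
have -> : (map snd G)`_l = g l by rewrite (nth_map (1%N, 0)).
have [dl0 hl] := gh l (ltn_ord l); rewrite (pihomogM _ _ hl).
case: ifP => le; last exact: lspan0.
apply: (lspanM (IH _ _ _ (pihomogP _ _ _))); first by rewrite ltn_subrL dl0 (leq_trans dl0).
move=> _ [w [e [Ww we ->]]]; apply: lspan_mem; exists w, (fun k => e k + (k == l))%N; split=> //.
  rewrite -(subnK le) -we -addnA; congr addn.
  under eq_bigr => k _ do rewrite mulnDl.
  rewrite big_split /=; congr addn; rewrite (bigD1 l) //= eqxx mul1n big1 ?addn0 //.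
  by move=> k; rewrite -val_eqE /= => /negPf->; rewrite mul0n.
rewrite /power_product -mulrA; congr (_ * _).
under [RHS]eq_bigr => k _ do rewrite exprD.
rewrite big_split /=; congr (_ * _); rewrite (bigD1 l) //= eqxx expr1 big1 ?mulr1 //.
by move=> k; rewrite -val_eqE /= => /negPf->; rewrite expr0.
Qed.

(** A counting form of the fact that [size G] homogeneous elements lower the dimension by at most
    [size G]: if [W] grows with exponent [t], the spanners grow with exponent at most [t + size G],
    yet they span all monomials in [m] variables. *)
Lemma span_growth t :
  (forall d, (#|[pred w : 'X_{1..m < d.+1} | W w]| <= (4 * d).+1 ^ t)%N) ->
  (m <= t + N)%N.
Proof.
move=> Wcount; rewrite leqNgt; apply/negP => lt.
(* Monomials with exponents at most [d'] have degree at most [d]. The comparison ends in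
   [d'.+1 <= (4 * m).+1 ^ m.-1], which this [d'] violates. *)
pose d' := ((4 * m).+1 ^ m)%N; pose d := (m * d')%N.
pose U := {ffun 'I_m -> 'I_d'.+1}.
pose F := ({w : 'X_{1..m < d.+1} | W w} * {ffun 'I_N -> 'I_d.+1})%type.
pose mon (h : U) : 'X_{1..m} := [multinom (h i : nat) | i < m].
pose z (x : F) := power_product (val (val x.1)) (fun l => if insub l is Some l' then x.2 l' : nat else 0%N).
have injmon : injective mon.
  by move=> h1 h2 /mnmP e; apply/ffunP => i; apply: val_inj; have := e i; rewrite !mnmE.
have : (#|U| <= #|{: F}|)%N.
  apply: (@span_card _ _ mon z) => // h.
  have hd : (mdeg (mon h) <= d)%N.
    rewrite mdegE; apply: leq_trans (_ : \sum_(i < m) d' <= _)%N.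
      by apply: leq_sum => i _; rewrite mnmE -ltnS.
    by rewrite sum_nat_const card_ord.
  have : ('X_[mon h] : poly) \is (mdeg (mon h)).-homog by rewrite dhomogX.
  move=> /homog_span/(_ (fun p => exists c : F -> K, p = \sum_y c y *: z y)); apply.
  - by exists (fun _ => 0); rewrite big1 // => x _; rewrite scale0r.
  - move=> _ _ [c ->] [c' ->]; exists (fun y => c y + c' y).
    by rewrite -big_split; apply: eq_bigr => x _; rewrite scalerDl.
  - move=> k _ [c ->]; exists (fun y => k * c y).
    by rewrite scaler_sumr; apply: eq_bigr => x _; rewrite scalerA.
  move=> _ [w [c [Ww wc ->]]].
  have wd : (mdeg w < d.+1)%N by rewrite ltnS; apply: leq_trans hd; rewrite -wc leq_addr.
  have cd (l : 'I_N) : (c l < d.+1)%N.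
    rewrite ltnS; apply: leq_trans hd; rewrite -wc (bigD1 l) //=.
    have [dl0 _] : (0 < dg l)%N /\ g l \is (dg l).-homog by apply: G_homog; apply: mem_nth.
    apply: leq_trans (_ : c l * dg l <= _)%N; first by rewrite leq_pmulr.
    by rewrite addnCA leq_addr.
  pose x0 : F := (exist _ (BMultinom wd) Ww, [ffun l => Ordinal (cd l)]).
  exists (fun y => (y == x0)%:R); rewrite (bigD1 x0) //= eqxx scale1r big1 ?addr0.
    rewrite /z /power_product /=; congr (_ * _); apply: eq_bigr => l _.
    by rewrite valK ffunE.
  by move=> x /negPf->; rewrite scale0r.
rewrite card_prod card_sig !card_ffun !card_ord => le.
have : (d'.+1 ^ m <= (4 * d).+1 ^ (t + N))%N.
  apply: leq_trans le _; rewrite expnD leq_mul ?Wcount //.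
  have [->|N0] := posnP N; first by rewrite !expn0.
  by rewrite leq_exp2r // ltnS leq_pmull.
have : ((4 * d).+1 ^ (t + N) <= (4 * d).+1 ^ m.-1)%N.
  by rewrite leq_pexp2l // -ltnS prednK // (leq_ltn_trans _ lt).
move=> h1 h2; have {h1 h2} := leq_trans h2 h1.
have m0 : (0 < m)%N by rewrite (leq_ltn_trans _ lt).
have : ((4 * d).+1 ^ m.-1 <= ((4 * m).+1 * d'.+1) ^ m.-1)%N.
  have [->|p0] := posnP m.-1; first by rewrite !expn0.
  by rewrite leq_exp2r // /d; clear; nia.
move=> h1 h2; have {h1 h2} := leq_trans h2 h1.
rewrite expnMn -{1}(prednK m0) expnS leq_mul2r expn_eq0 /=.
rewrite ltnNge leq_pexp2l //; last exact: leq_pred.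
Qed.

End Spanning.

(** * Lattice generation and domination *)

Section MonomialSums.
Variables (K : fieldType) (m : nat) (chi : 'X_{1..m} -> K).
Implicit Types p q : {mpoly K[m]}.

(** The linear functional taking the value [chi w] at the monomial [w]. *)
Definition msum p := \sum_(w <- msupp p) p@_w * chi w.

Lemma msumwE k p : (msize p <= k)%N -> msum p = \sum_(w : 'X_{1..m < k}) p@_w * chi w.
Proof.
move=> lt_pk; pose I : subFinType _ := 'X_{1..m < k}.
rewrite /msum (big_mksub I) //=; first last.
+ by move=> x /msize_mdeg_lt /leq_trans /(_ lt_pk) ->.
+ by rewrite msupp_uniq.
rewrite big_rmcond //= => w /memN_msupp_eq0 ->; by rewrite mul0r.
Qed.

Lemma msumD p q : msum (p + q) = msum p + msum q.
Proof.
pose k := maxn (msize p) (msize q).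
rewrite !(@msumwE k) ?leq_maxl ?leq_maxr ?msizeD_le // -big_split /=.
by apply: eq_bigr => w _; rewrite mcoeffD mulrDl.
Qed.

Lemma msumZ c p : msum (c *: p) = c * msum p.
Proof.
rewrite !(@msumwE (msize p)) ?mmeasureZ_le // big_distrr /=.
by apply: eq_bigr => w _; rewrite mcoeffZ mulrA.
Qed.

Lemma msumX w : msum 'X_[w] = chi w.
Proof. by rewrite /msum msuppX big_seq1 mcoeffX eqxx mul1r. Qed.

Lemma msum0 : msum 0 = 0. Proof. by rewrite /msum msupp0 big_nil. Qed.

Lemma msumB p q : msum (p - q) = msum p - msum q.
Proof. by rewrite msumD -scaleN1r msumZ mulN1r. Qed.

Lemma msum_ideal (s : seq {mpoly K[m]}) p :
  (forall b w, b \in s -> msum ('X_[w] * b) = 0) -> in_ideal_gen s p -> msum p = 0.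
Proof.
move=> h [c ->]; elim/big_ind: _ => [||i _]; first exact: msum0.
  by move=> x y hx hy; rewrite msumD hx hy addr0.
rewrite [c i]mpolyE big_distrl /=; elim/big_ind: _ => [||w _]; first exact: msum0.
  by move=> x y hx hy; rewrite msumD hx hy addr0.
by rewrite -scalerAl msumZ h ?mulr0 // mem_tnth.
Qed.

End MonomialSums.

Section Lattice.
Variables (n m : nat) (ends : 'I_m -> 'I_n * 'I_n) (K : fieldType).
Local Notation pair_t := ('X_{1..m} * 'X_{1..m})%type.
Local Notation I := (toric_ideal ends K).
Local Notation vdeg := (vdeg ends).

Definition pure_binomial (r : pair_t) : {mpoly K[m]} := 'X_[r.1] - 'X_[r.2].

(** The functional summing the coefficients of all monomials congruent to [v] modulo the lattice
    spanned by [S] kills every monomial multiple of a generator, as its two monomials are congruent.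
    It hence kills the toric binomial of [u] and [v], which forces [u] to be congruent to [v]. *)
Lemma toric_lattice_generates (S : seq pair_t) : uniq S ->
  generates I (map pure_binomial S) -> lattice_generates ends setT S.
Proof.
move=> uS gen c _ c0.
pose u : 'X_{1..m} := [multinom (if (0 <= c e)%R then `|c e|%N else 0%N) | e < m].
pose v : 'X_{1..m} := [multinom (if (0 <= c e)%R then 0%N else `|c e|%N) | e < m].
have uvE e : Posz (u e) - Posz (v e) = c e.
  rewrite !mnmE; case: ifP => [ge|lt]; first by rewrite subr0 gez0_abs.
  by rewrite sub0r ltz0_abs ?opprK // ltNge lt.
pose cong (w : 'X_{1..m}) := exists k : pair_t -> int,
  forall e, Posz (w e) - Posz (v e) = \sum_(r <- S) k r * exponent r e.
pose chi w : K := if excluded_middle_informative (cong w) then 1 else 0.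
have congS (r : pair_t) w : r \in S -> cong (w + r.1)%MM <-> cong (w + r.2)%MM.
  have shift (k : pair_t -> int) (t : int) e : r \in S ->
      \sum_(r' <- S) (k r' + (r' == r)%:R * t) * exponent r' e =
      \sum_(r' <- S) k r' * exponent r' e + t * exponent r e.
    move=> rS; under eq_bigr => r' _ do rewrite mulrDl.
    rewrite big_split /=; congr (_ + _); rewrite (bigD1_seq r) //= eqxx mul1r big1 ?addr0 //.
    by move=> r' /negPf->; rewrite !mul0r.
  move=> rS; split=> -[k kE].
    exists (fun r' => k r' + (r' == r)%:R * -1) => e; rewrite shift // -kE.
    by rewrite !mnmDE !PoszD /exponent; ring.
  exists (fun r' => k r' + (r' == r)%:R * 1) => e; rewrite shift // -kE.
  by rewrite !mnmDE !PoszD /exponent; ring.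
have uvI : I ('X_[u] - 'X_[v]).
  apply/toric_binomial => x; have := c0 x.
  rewrite -(eq_zdeg _ _ uvE) (zdeg_exponent ends (u, v)) => /eqP.
  by rewrite subr_eq0 eqz_nat => /eqP.
have : msum chi ('X_[u] - 'X_[v]) = 0.
  apply: (@msum_ideal _ _ _ (map pure_binomial S)); last exact/gen.
  move=> _ w /mapP[r rS ->]; rewrite mulrBr -!mpolyXD msumB !msumX /chi.
  have := congS r w rS.
  case: excluded_middle_informative => h1; case: excluded_middle_informative => h2 [h3 h4];
    rewrite ?subrr //; first by case: h2; exact: h3.
  by case: h1; exact: h4.
have chiv : chi v = 1.
  rewrite /chi; case: excluded_middle_informative => // -[]; exists (fun _ => 0) => e.
  by rewrite subrr big1 // => r _; rewrite mul0r.
rewrite msumB !msumX chiv /chi.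
case: excluded_middle_informative => [[k kE] _|nc /eqP]; last first.
  by rewrite sub0r oppr_eq0 oner_eq0.
by exists k => e; rewrite -uvE.
Qed.

End Lattice.

Arguments pure_binomial {m} K r.

Section Domination.
Variables (n m : nat) (ends : 'I_m -> 'I_n * 'I_n) (K : fieldType).
Hypothesis simple : simple_graph ends.
Local Notation pair_t := ('X_{1..m} * 'X_{1..m})%type.
Local Notation I := (toric_ideal ends K).
Local Notation vdeg := (vdeg ends).
Local Notation vmon := (vmon ends).
Implicit Types u w : 'X_{1..m}.

Section Counting.
Variable j : 'I_m.
Let x0 := (ends j).1.

(* Modulo the degree of the edge [j] a vertex degree has at most one
   representative that is minimal for [j]; this lowers the growth exponent of
   normal monomials below the rank of the incidence matrix. *)
Definition degree_repr u := choose (fun w => vmon w == vmon u) u.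

Definition edge_minimal w :=
  ~~ [exists u : 'X_{1..m < (mdeg w).+1}, vmon (u + U_(j))%MM == vmon w].

Definition normal_monomial w := (w == degree_repr w) && edge_minimal w.

Lemma vmon_repr u : vmon (degree_repr u) = vmon u.
Proof. exact/eqP/(chooseP (P := fun w => vmon w == vmon u)). Qed.

Lemma eq_degree_repr u w : vmon u = vmon w -> degree_repr u = degree_repr w.
Proof.
move=> e; rewrite /degree_repr e; apply: choose_id; by rewrite ?e.
Qed.

(** Vertex degrees modulo that of the edge [j]: every row is cleared at [x0] by means of the row of
    [j]. *)
Definition reduced_mx : 'M[rat]_(m, n) := \matrix_(e, y)
  ((incidence ends e y)%:R - (incidence ends e x0)%:R * (incidence ends j y)%:R).

Lemma incidence_x0 : incidence ends j x0 = 1%N.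
Proof.
by have := simple.1 j; rewrite /incidence /x0 eqxx eq_sym => /negPf->.
Qed.

Lemma incidence_le1 y : (incidence ends j y <= 1)%N.
Proof.
have := simple.1 j; rewrite /incidence.
have [->|_ _] := eqVneq (ends j).1 y; first by rewrite eq_sym => /negPf->.
by rewrite add0n leq_b1.
Qed.

(** The reduced rows all vanish at [x0], whereas the incidence row of [j] does not. *)
Lemma rank_reduced : (\rank reduced_mx^T < \rank (incidence_mx ends))%N.
Proof.
rewrite mxrank_tr; apply: rank_ltmx; rewrite /ltmx; apply/andP; split.
  apply/row_subP => e.
  have -> : row e reduced_mx = row e (incidence_mx ends) -
      (incidence ends e x0)%:R *: row j (incidence_mx ends).
    by apply/rowP => y; rewrite !mxE.
  by rewrite addmx_sub ?row_sub // eqmx_opp scalemx_sub ?row_sub.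
apply/negP => /(submx_trans (row_sub j _))/submxP[D /rowP/(_ x0)].
rewrite !mxE incidence_x0 big1 => [/eqP|e _]; first by rewrite oner_eq0.
by rewrite !mxE incidence_x0 mulr1 subrr mulr0.
Qed.

Let f := maxrankfun reduced_mx^T.

Lemma reduced_determined (v : 'rV[rat]_m) :
  (forall i, (v *m reduced_mx) 0 (f i) = 0) -> v *m reduced_mx = 0.
Proof.
move=> h; apply: trmx_inj; rewrite trmx_mul trmx0.
have /submxP[D DE] : (reduced_mx^T <= rowsub f reduced_mx^T)%MS by rewrite eq_maxrowsub.
rewrite DE -mulmxA (_ : rowsub f _ *m _ = 0) ?mulmx0 //.
apply/matrixP => i k; rewrite ord1 !mxE -{}[RHS](h i) mxE; apply: eq_bigr => e _.
by rewrite !mxE mulrC.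
Qed.

Lemma vdeg_le w y : (vdeg w y <= 2 * mdeg w)%N.
Proof. by rewrite mul2n -(sum_vdeg ends) (bigD1 y) //= leq_addr. Qed.

(** Reduced degrees at the columns chosen by [f], shifted by [2 * d] to stay natural. Vertex degrees
    are at most [2 * d], so the values are at most [4 * d]. *)
Let key d (w : 'X_{1..m}) : {ffun 'I_(\rank reduced_mx^T) -> 'I_(4 * d).+1} :=
  [ffun i => inord (vdeg w (f i) + (2 * d - vdeg w x0 * incidence ends j (f i)))].

(** Equal keys make the vertex degrees differ by [k] times that of [j]. For positive [k] one of the
    monomials has the degree of a multiple of the variable [j], against its minimality; for [k = 0]
    both are the representative of the same degree. *)
Lemma key_inj d w w' : (mdeg w <= d)%N -> (mdeg w' <= d)%N ->
  normal_monomial w -> normal_monomial w' -> key d w = key d w' -> w = w'.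
Proof.
move=> wd wd' nw nw' /ffunP keq.
have le u y : (mdeg u <= d)%N -> (vdeg u y <= 2 * d)%N.
  by move=> ud; apply: leq_trans (vdeg_le u y) _; rewrite leq_mul2l.
have le' u y : (mdeg u <= d)%N -> (vdeg u x0 * incidence ends j y <= 2 * d)%N.
  move=> ud; apply: leq_trans (le u x0 ud); rewrite -[leqRHS]muln1 leq_mul2l incidence_le1.
  by rewrite orbT.
pose v : 'rV[rat]_m := \row_e ((w e)%:R - (w' e)%:R).
have vE y : (v *m reduced_mx) 0 y = (vdeg w y)%:R - (vdeg w' y)%:R -
    ((vdeg w x0)%:R - (vdeg w' x0)%:R) * (incidence ends j y)%:R.
  have vdE u z : (vdeg u z)%:R = \sum_e (u e)%:R * (incidence ends e z)%:R :> rat.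
    by rewrite natr_sum; apply: eq_bigr => e _; rewrite natrM.
  rewrite !mxE !vdE -!sumrB big_distrl /= -sumrB; apply: eq_bigr => e _.
  by rewrite !mxE; ring.
have ratE (a a' b b' i : rat) : a + b' * i = a' + b * i <-> a - a' - (b - b') * i = 0.
  by split=> h; lra.
have v0 : v *m reduced_mx = 0.
  apply: reduced_determined => i; rewrite vE.
  have := keq i; rewrite !ffunE => /(congr1 val) /=.
  have bnd u : (mdeg u <= d)%N ->
      (vdeg u (f i) + (2 * d - vdeg u x0 * incidence ends j (f i)) < (4 * d).+1)%N.
    by move=> ud; have := le u (f i) ud; clear; lia.
  rewrite !inordK ?bnd // => E.
  have : (vdeg w (f i) + vdeg w' x0 * incidence ends j (f i) =
      vdeg w' (f i) + vdeg w x0 * incidence ends j (f i))%N.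
    have aux (a a' b b' k : nat) : (a + (k - b) = a' + (k - b') -> b <= k -> b' <= k ->
      a + b' = a' + b)%N by clear; lia.
    exact: aux E (le' w (f i) wd) (le' w' (f i) wd').
  by move=> E2; apply/ratE; rewrite -!natrM -!natrD E2.
have dE y : (vdeg w y)%:R + (vdeg w' x0)%:R * (incidence ends j y)%:R =
    (vdeg w' y)%:R + (vdeg w x0)%:R * (incidence ends j y)%:R :> rat.
  by apply/ratE; rewrite -vE v0 mxE.
have {}dE y : (vdeg w y + vdeg w' x0 * incidence ends j y =
    vdeg w' y + vdeg w x0 * incidence ends j y)%N.
  by apply/eqP; rewrite -(eqr_nat rat); have := dE y; rewrite -!natrM -!natrD => ->.
clear v v0 vE keq; wlog le0 : w w' wd wd' nw nw' dE / (vdeg w' x0 <= vdeg w x0)%N.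
  move=> wl; case: (leqP (vdeg w' x0) (vdeg w x0)) => [|/ltnW] h; first exact: wl.
  by apply/esym/wl.
pose k := (vdeg w x0 - vdeg w' x0)%N.
have vw : vmon w = vmon (w' + U_(j) *+ k)%MM.
  apply/vmonP => y; rewrite vdegD.
  have -> : vdeg (U_(j) *+ k)%MM y = (k * incidence ends j y)%N.
    by elim: (k) => [|k' ih]; rewrite ?mulm0n ?vdeg0 // mulmS vdegD vdegU ih mulSn.
  have := dE y; rewrite /k mulnBl.
  have : (vdeg w' x0 * incidence ends j y <= vdeg w x0 * incidence ends j y)%N.
    by rewrite leq_mul2r le0 orbT.
  by clear; lia.
case: (posnP k) => [k0|kp].
  rewrite k0 mulm0n addm0 in vw.
  case/andP: nw => /eqP -> _; case/andP: nw' => /eqP -> _; exact: eq_degree_repr.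
case/andP: nw => _ /negP[].
pose u := (w' + U_(j) *+ k.-1)%MM.
have uE : vmon (u + U_(j))%MM = vmon w.
  by rewrite vw /u -addmA -mulmSr prednK.
have ud : (mdeg u < (mdeg w).+1)%N.
  move/vmonP/eq_vdeg_mdeg: uE; rewrite mdegD => <-; by rewrite ltnS leq_addr.
by apply/existsP; exists (BMultinom ud); rewrite uE.
Qed.

Lemma card_normal d :
  (#|[pred w : 'X_{1..m < d.+1} | normal_monomial w]| <= (4 * d).+1 ^ \rank reduced_mx^T)%N.
Proof.
set A := [pred _ | _]; rewrite -(card_in_imset (f := fun w : 'X_{1..m < d.+1} => key d w)).
  apply: leq_trans (max_card _) _; by rewrite card_ffun !card_ord.
move=> w w' nw nw' e; apply: val_inj; apply: key_inj e => //; rewrite -ltnS; exact: bmdeg.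
Qed.

End Counting.

Lemma toric_dominating (S : seq pair_t) :
  (forall r, r \in S -> vdeg r.1 =1 vdeg r.2) -> (forall r, r \in S -> r.1 != 0%MM) ->
  generates I (map (pure_binomial K) S) ->
  (size S + \rank (incidence_mx ends) <= m)%N ->
  dominating setT (map support_row S).
Proof.
move=> degS neS gen leS; apply/dominatingP => T _ /set0Pn[j jT].
rewrite ltnNge; apply/negP => leT; rewrite count_map in leT.
(* If at least [#|T|] rows are mixed, [G] has at most [size S] elements. It still generates every
   mixed binomial, both of whose monomials contain a variable of [T]. *)
pose G : seq (nat * {mpoly K[m]}) := [seq (1%N, 'X_i) | i <- enum T] ++
  [seq (mdeg r.1, pure_binomial K r) | r <- S & ~~ mixed T (support_row r)].
have inT i : i \in T -> in_ideal_gen (map snd G) 'X_i.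
  move=> iT; apply: in_ideal_gen_mem; rewrite map_cat mem_cat -map_comp.
  by apply/orP; left; apply: map_f; rewrite mem_enum.
have Qid := in_ideal_gen_ideal (map snd G).
have monT (u : 'X_{1..m}) : touches (msupport u) T -> in_ideal_gen (map snd G) 'X_[u].
  move=> /touchesP[i]; rewrite inE => ui iT.
  have le : (U_(i) <= u)%MM by rewrite lep1mP.
  by rewrite -[u](submK le) mpolyXD; case: Qid => _ _; apply; exact: inT.
have IQ p : I p -> in_ideal_gen (map snd G) p.
  move=> /gen; apply: in_ideal_gen_min => // _ /mapP[r rS ->].
  have [/andP[m1 m2]|nm] := boolP (mixed T (support_row r)).
    case: (Qid) => _ QD QM; apply: QD; first exact: monT.
    by rewrite -mulN1r; apply: QM; apply: monT.
  apply: in_ideal_gen_mem; rewrite map_cat mem_cat; apply/orP; right.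
  by rewrite -map_comp; apply: map_f; rewrite mem_filter nm.
have := @span_growth K m G (normal_monomial j) _ _ _ (card_normal j).
have -> : size G = (#|T| + count (predC (fun r => mixed T (support_row r))) S)%N.
  by rewrite size_cat !size_map -cardE size_filter.
have := count_predC (fun r => mixed T (support_row r)) S; have := rank_reduced j.
move: leT leS; rewrite /preim.
move=> h1 h2 h3 h4 h5; suff : (m < m)%N by rewrite ltnn.
have aux (a b c s k l t : nat) : (a <= b -> s + k <= l -> t < k -> b + c = s ->
  t + (a + c) < l)%N by clear; lia.
apply: leq_ltn_trans (h5 _ _) _; last exact: aux h1 h2 h3 h4.
- move=> y; rewrite mem_cat => /orP[/mapP[i _ ->]|/mapP[r]].
    by rewrite dhomogX /= mdeg1.
  rewrite mem_filter => /andP[_ rS] -> /=; split.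
    by rewrite lt0n mdeg_eq0 neS.
  by rewrite rpredB // dhomogX //= (eq_vdeg_mdeg (degS _ rS)).
(* If the representative is not minimal for [j], then [u] is congruent modulo the toric ideal to a
   multiple of the variable [j], which belongs to [G]. *)
- move=> u; have [mi|nmi] := boolP (edge_minimal j (degree_repr u)); [right|left].
    exists (degree_repr u); split.
    + by rewrite /normal_monomial mi andbT; apply/eqP/esym/eq_degree_repr/vmon_repr.
    + by apply: (@eq_vdeg_mdeg _ _ ends); apply/vmonP/vmon_repr.
    + by apply: IQ; apply/toric_binomial; apply/vmonP; rewrite vmon_repr.
  case/negPn/existsP: nmi => [w /eqP]; rewrite vmon_repr => wE.
  rewrite -(subrK 'X_[w + U_(j)] 'X_[u]); case: (Qid) => _ QD QM; apply: QD.
    by apply: IQ; apply/toric_binomial; apply/vmonP.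
  by rewrite mpolyXD; apply: QM; apply: inT.
Qed.

End Domination.

Theorem theorem5p1 (K : fieldType) (n m : nat) (ends : 'I_m -> 'I_n * 'I_n)
  (Hsimple : simple_graph ends) (Hconn : connected_graph ends)
  (HCI : complete_intersection (toric_ideal ends K)) :
  forall B : {mpoly K[m]}, minimal_generator (toric_ideal ends K) B ->
    exists (vs : seq 'I_n) (es : seq 'I_m),
      circuit_walk ends vs es /\
      (B = walk_binomial K es \/ B = - walk_binomial K es).
Proof.
move=> B [s [[bins gen irr] Bs]].
have [S sE] : exists S, s = map (pure_binomial K) S.
  elim: (s) bins => [|b s' ih] bins; first by exists [::].
  have [|S ->] := ih; first by move=> b' b's; apply: bins; rewrite inE b's orbT.
  by have [u [v ->]] := bins b (mem_head _ _); exists ((u, v) :: S).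
have indep k : (k < size s)%N -> ~ in_ideal_gen (take k s ++ drop k.+1 s) s`_k.
  by move=> ks h; apply: (irr k ks); exact: generates_remove.
have us : uniq s.
  apply/negPn/negP => /(uniqPn 0)[k [l [kl ls E]]].
  apply: (indep k (ltn_trans kl ls)); rewrite E; apply: in_ideal_gen_mem.
  by apply: mem_remove; rewrite // gtn_eqF.
have degS r : r \in S -> vdeg ends r.1 =1 vdeg ends r.2.
  move=> rS; apply/(toric_binomial ends K)/gen/in_ideal_gen_mem.
  by rewrite sE; apply: (map_f (pure_binomial K)).
have neS r : r \in S -> r.1 != r.2.
  move=> rS; apply/eqP => r12; have rs : pure_binomial K r \in s by rewrite sE map_f.
  have := indep (index (pure_binomial K r) s); rewrite index_mem => /(_ rs); apply.
  rewrite nth_index //; set s' := take _ _ ++ _.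
  by rewrite /pure_binomial r12 subrr; case: (in_ideal_gen_ideal s').
(* The two monomials of a generator have the same total degree, so if one were 1 both would be and
   the generator would vanish. *)
have deg0 u v : vdeg ends u =1 vdeg ends v -> u = 0%MM -> v = 0%MM.
  by move=> /eq_vdeg_mdeg uv u0; apply/eqP; rewrite -mdeg_eq0 -uv u0 mdeg0.
have ne1 r : r \in S -> r.1 != 0%MM.
  move=> rS; apply: contra (neS r rS) => /eqP r1.
  by rewrite r1 (deg0 _ _ (degS r rS) r1).
have ne2 r : r \in S -> r.2 != 0%MM.
  move=> rS; apply: contra (neS r rS) => /eqP r2.
  by rewrite r2 (deg0 r.2 r.1 _ r2) // => x; rewrite degS.
have homS b : b \in s -> exists d, b \is d.-homog.
  rewrite sE => /mapP[r rS ->]; exists (mdeg r.1); rewrite rpredB // dhomogX //=.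
  by rewrite (eq_vdeg_mdeg (degS r rS)).
have [h [t [hI th gent]]] := HCI.
have leS : (size S + \rank (incidence_mx ends) <= m)%N.
  apply: leq_trans (toric_height_bound hI); rewrite leq_add2r -th.
  by have := minimal_generators_size homS gen irr gent; rewrite sE size_map.
rewrite sE in gen us Bs.
have dom := toric_dominating Hsimple degS ne1 gen leS.
have rin : rows_in setT (map support_row S).
  apply/allP => _ /mapP[r rS ->]; rewrite /= !subsetT.
  have [e1 h1] := mnm_neq0 (ne1 r rS); have [e2 h2] := mnm_neq0 (ne2 r rS).
  by rewrite !andbT; apply/andP; split; apply/set0Pn; [exists e1|exists e2]; rewrite inE.
case/mapP: Bs => r rS ->.
have [C1 [C2 [dis s1 s2 rk]]] :=
  glued degS rin dom (toric_lattice_generates (map_uniq us) gen) rS.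
have [e _] := mnm_neq0 (ne1 r rS).
exact: (gluing_circuit Hsimple e dis s1 s2 (degS r rS) rk K (ne1 r rS)).
Qed.
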